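(* For $\mathbf G=SL_2(\bar{\mathbb F}_q)$, the category $\mathscr C(\mathbf G)$ is an abelian category.
   Context: Let $\mathbb{F}_q$ be a finite field with $q$ elements, $\bar{\mathbb{F}}_q$ its algebraic closure, and $\Bbbk$ an algebraically closed field of characteristic $0$. Let $\mathbf G=SL_2(\bar{\mathbb F}_q)$, regarded as an abstract group, with $\Bbbk\mathbf G$ its group algebra. Let $\mathbf T$, $\mathbf B$, $\mathbf U$ be the subgroups of diagonal, upper triangular, and upper unitriangular matrices respectively. Let $\widehat{\mathbf T}$ be the set of all (abstract) group homomorphisms $\mathbf T\to\Bbbk^*$. For a $\Bbbk\mathbf G$-module $M$ and $\lambda\in\widehat{\mathbf T}$ let $M_\lambda=\{\xi\in M\mid t\xi=\lambda(t)\xi\ \forall t\in\mathbf T\}$, $M^{\mathbf T}=\bigoplus_{\lambda\in\widehat{\mathbf T}}M_\lambda$ and $\mathfrak d(M)=\dim M^{\mathbf T}$. A $\mathbf T$-eigenvector is an element of some $M_\lambda$. The category $\mathscr C(\mathbf G)$ is the full subcategory of the category of $\Bbbk\mathbf G$-modules whose objects are those $M$ such that $n=\mathfrak d(M)<+\infty$ and there exist $\mathbf T$-eigenvectors $\xi_1,\dots,\xi_n\in M$ with $M\cong\bigoplus_{i=1}^n\Bbbk\mathbf U\xi_i$ as $\Bbbk\mathbf B$-modules. *)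

(* Defs.v *)
From HB Require Import structures.
From mathcomp Require Import all_boot all_order all_fingroup all_algebra all_field.
From mathcomp Require Import boolp.

Set Implicit Arguments.
Unset Strict Implicit.
Unset Printing Implicit Defensive.

Import GRing.Theory.
Local Open Scope ring_scope.

(* Preadditive categories: Hom-sets are abelian groups and composition is     *)
(* bilinear; [ccomp g f] is g after f.                                        *)
Record precat := Precat {
  cob :> Type;
  chom : cob -> cob -> zmodType;
  cid : forall X, chom X X;
  ccomp : forall X Y Z, chom Y Z -> chom X Y -> chom X Z;
  ccompA : forall X Y Z W (h : chom Z W) (g : chom Y Z) (f : chom X Y),
    ccomp h (ccomp g f) = ccomp (ccomp h g) f;
  ccomp1m : forall X Y (f : chom X Y), ccomp (cid Y) f = f;
  ccompm1 : forall X Y (f : chom X Y), ccomp f (cid X) = f;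
  ccompDl : forall X Y Z (g g' : chom Y Z) (f : chom X Y),
    ccomp (g + g') f = ccomp g f + ccomp g' f;
  ccompDr : forall X Y Z (g : chom Y Z) (f f' : chom X Y),
    ccomp g (f + f') = ccomp g f + ccomp g f'
}.

Arguments cid {p} X.

Section Abelian.
Variable C : precat.
Local Notation "g \\o f" := (@ccomp C _ _ _ g f) (at level 40, left associativity).

(* Both initial and terminal; Hom-groups always contain 0, so uniqueness of   *)
(* the morphism is the only requirement.                                      *)
Definition is_zero_object (Z : C) :=
  forall X : C, (forall f : chom Z X, f = 0) /\ (forall f : chom X Z, f = 0).

Definition is_biproduct (X Y P : C) (iX : chom X P) (iY : chom Y P)
    (pX : chom P X) (pY : chom P Y) :=
  [/\ pX \\o iX = cid X, pY \\o iY = cid Y, pX \\o iY = 0, pY \\o iX = 0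
    & iX \\o pX + iY \\o pY = cid P].

Definition is_kernel (X Y K : C) (f : chom X Y) (i : chom K X) :=
  f \\o i = 0 /\
  forall (Z : C) (h : chom Z X), f \\o h = 0 -> exists! u : chom Z K, i \\o u = h.

Definition is_cokernel (X Y Q : C) (f : chom X Y) (p : chom Y Q) :=
  p \\o f = 0 /\
  forall (Z : C) (h : chom Y Z), h \\o f = 0 -> exists! u : chom Q Z, u \\o p = h.

Definition is_mono (X Y : C) (f : chom X Y) :=
  forall (Z : C) (g h : chom Z X), f \\o g = f \\o h -> g = h.

Definition is_epi (X Y : C) (f : chom X Y) :=
  forall (Z : C) (g h : chom Y Z), g \\o f = h \\o f -> g = h.

Record is_abelian : Prop := IsAbelian {
  abelian_zero : exists Z : C, is_zero_object Z;
  abelian_biproduct : forall X Y : C, exists (P : C) (iX : chom X P)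
    (iY : chom Y P) (pX : chom P X) (pY : chom P Y), is_biproduct iX iY pX pY;
  abelian_kernel : forall (X Y : C) (f : chom X Y),
    exists (K : C) (i : chom K X), is_kernel f i;
  abelian_cokernel : forall (X Y : C) (f : chom X Y),
    exists (Q : C) (p : chom Y Q), is_cokernel f p;
  abelian_mono : forall (X Y : C) (f : chom X Y), is_mono f ->
    exists (Z : C) (g : chom Y Z), is_kernel g f;
  abelian_epi : forall (X Y : C) (f : chom X Y), is_epi f ->
    exists (Z : C) (g : chom Z X), is_cokernel g f
}.

Definition full_subcat (P : C -> Prop) : precat :=
  @Precat {X : C | P X} (fun X Y => chom (sval X) (sval Y))
    (fun X => cid (sval X)) (fun X Y Z g f => g \\o f)
    (fun X Y Z W h g f => ccompA h g f)
    (fun X Y f => ccomp1m f) (fun X Y f => ccompm1 f)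
    (fun X Y Z g g' f => ccompDl g g' f) (fun X Y Z g f f' => ccompDr g f f').

End Abelian.

(* A module over the group algebra kG of a (possibly infinite) group G, given *)
(* as a k-vector space with a linear action of G.                             *)
Record gmod (k : fieldType) (G : groupType) := Gmod {
  gcarrier :> lmodType k;
  gact : G -> gcarrier -> gcarrier;
  gact_linear : forall g, linear (gact g);
  gact1 : forall x, gact 1%g x = x;
  gactM : forall g h x, gact (g * h)%g x = gact g (gact h x)
}.

Section GmodHom.
Variables (k : fieldType) (G : groupType).

Record ghom (M N : gmod k G) := Ghom {
  ghom_fun :> M -> N;
  ghom_linear : linear ghom_fun;
  ghom_equiv : forall g x, ghom_fun (gact g x) = gact g (ghom_fun x)
}.

Lemma ghom_ext (M N : gmod k G) (f g : ghom M N) : f =1 g -> f = g.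
Proof.
case: f g => [f fl fe] [g gl ge] /= /funext efg.
by subst g; rewrite (Prop_irrelevance fl gl) (Prop_irrelevance fe ge).
Qed.

HB.instance Definition _ (M N : gmod k G) (f : ghom M N) :=
  GRing.isLinear.Build k M N _ f (ghom_linear f).
HB.instance Definition _ (M : gmod k G) (g : G) :=
  GRing.isLinear.Build k M M _ (gact g) (gact_linear g).

Section Zmod.
Variables M N : gmod k G.
Implicit Types f g : ghom M N.

Definition ghom_zero : ghom M N.
Proof.
apply: (@Ghom _ _ (fun=> 0)) => [a x y|g x]; first by rewrite scaler0 addr0.
by rewrite linear0.
Defined.

Definition ghom_add f g : ghom M N.
Proof.
apply: (@Ghom _ _ (fun x => f x + g x)) => [a x y|h x].
  by rewrite !linearP scalerDr addrACA.
by rewrite !ghom_equiv linearD.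
Defined.

Definition ghom_opp f : ghom M N.
Proof.
apply: (@Ghom _ _ (fun x => - f x)) => [a x y|h x].
  by rewrite linearP opprD scalerN.
by rewrite ghom_equiv linearN.
Defined.

Lemma ghom_addA : associative ghom_add.
Proof. by move=> f g h; apply: ghom_ext => x /=; rewrite addrA. Qed.
Lemma ghom_addC : commutative ghom_add.
Proof. by move=> f g; apply: ghom_ext => x /=; rewrite addrC. Qed.
Lemma ghom_add0 : left_id ghom_zero ghom_add.
Proof. by move=> f; apply: ghom_ext => x /=; rewrite add0r. Qed.
Lemma ghom_addN : left_inverse ghom_zero ghom_opp ghom_add.
Proof. by move=> f; apply: ghom_ext => x /=; rewrite addNr. Qed.

HB.instance Definition _ := gen_eqMixin (ghom M N).
HB.instance Definition _ := gen_choiceMixin (ghom M N).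
HB.instance Definition _ := GRing.isZmodule.Build (ghom M N)
  ghom_addA ghom_addC ghom_add0 ghom_addN.
End Zmod.

Definition ghom_id (M : gmod k G) : ghom M M.
Proof. by apply: (@Ghom _ _ id). Defined.

Definition ghom_comp (M N P : gmod k G) (g : ghom N P) (f : ghom M N) : ghom M P.
Proof.
apply: (@Ghom _ _ (g \o f)) => [a x y|h x] /=; first by rewrite !linearP.
by rewrite !ghom_equiv.
Defined.

Definition gmod_cat : precat.
Proof.
apply: (@Precat (gmod k G) (fun M N => ghom M N) ghom_id ghom_comp);
  try by move=> *; apply: ghom_ext.
by move=> M N P g f f'; apply: ghom_ext => x /=; rewrite linearD.
Defined.

End GmodHom.

Section SL2.
Variable F : fieldType.

Record SL2 := MkSL2 { sl2val :> 'M[F]_2; sl2_det : \det sl2val == 1 }.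
HB.instance Definition _ := [isSub for sl2val].
HB.instance Definition _ := [Choice of SL2 by <:].

Fact sl2_one_subproof : \det (1%:M : 'M[F]_2) == 1.
Proof. by rewrite det1. Qed.
Fact sl2_mul_subproof (A B : SL2) : \det (A *m B) == 1.
Proof. by rewrite det_mulmx (eqP (sl2_det A)) (eqP (sl2_det B)) mulr1. Qed.
Fact sl2_inv_subproof (A : SL2) : \det (invmx A) == 1.
Proof. by rewrite det_inv (eqP (sl2_det A)) invr1. Qed.

Definition sl2_one := MkSL2 sl2_one_subproof.
Definition sl2_mul A B := MkSL2 (sl2_mul_subproof A B).
Definition sl2_inv A := MkSL2 (sl2_inv_subproof A).

Lemma sl2_unitmx (A : SL2) : (A : 'M[F]_2) \in unitmx.
Proof. by rewrite unitmxE (eqP (sl2_det A)) unitr1. Qed.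
Lemma sl2_mulA : associative sl2_mul.
Proof. by move=> A B D; apply: val_inj; rewrite /= mulmxA. Qed.
Lemma sl2_mul1 : left_id sl2_one sl2_mul.
Proof. by move=> A; apply: val_inj; rewrite /= mul1mx. Qed.
Lemma sl2_1mul : right_id sl2_one sl2_mul.
Proof. by move=> A; apply: val_inj; rewrite /= mulmx1. Qed.
Lemma sl2_mulV : left_inverse sl2_one sl2_inv sl2_mul.
Proof. by move=> A; apply: val_inj; rewrite /= mulVmx ?sl2_unitmx. Qed.
Lemma sl2_Vmul : right_inverse sl2_one sl2_inv sl2_mul.
Proof. by move=> A; apply: val_inj; rewrite /= mulmxV ?sl2_unitmx. Qed.

HB.instance Definition _ := isGroup.Build SL2
  sl2_mulA sl2_mul1 sl2_1mul sl2_mulV sl2_Vmul.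

Definition torus : {pred SL2} := fun A => is_diag_mx (A : 'M[F]_2).
Definition borel : {pred SL2} := fun A => (A : 'M[F]_2) 1 0 == 0.
Definition unipotent : {pred SL2} :=
  fun A => [&& (A : 'M[F]_2) 1 0 == 0, (A : 'M[F]_2) 0 0 == 1
             & (A : 'M[F]_2) 1 1 == 1].

Lemma torusM (s t : SL2) : s \in torus -> t \in torus -> (s * t)%g \in torus.
Proof.
rewrite /torus !unfold_in /=.
move=> /is_diag_mxP ds /is_diag_mxP dt.
apply/is_diag_mxP => i j ij; rewrite mxE big1 // => l _.
have [eil|il] := eqVneq (i : nat) l; last by rewrite ds ?mul0r.
by rewrite dt ?mulr0 // -eil.
Qed.

End SL2.

Arguments torus F : clear implicits.
Arguments borel F : clear implicits.
Arguments unipotent F : clear implicits.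

Section CategoryC.
Variables (F k : fieldType).
Local Notation G := (SL2 F).

(* Group homomorphisms from the torus to the units of k, given by functions   *)
(* on the subtype of G of elements of the torus.                              *)
Record torus_char := TorusChar {
  tchar :> {t : G | t \in torus F} -> k;
  tchar_neq0 : forall t, tchar t != 0;
  tcharM : forall s t : {t : G | t \in torus F},
    tchar (exist _ (val s * val t)%g (torusM (valP s) (valP t)))
    = tchar s * tchar t
}.

Section Module.
Variable M : gmod k G.

Definition weight_space (lam : torus_char) (x : M) : Prop :=
  forall t : {t : G | t \in torus F}, gact (val t) x = lam t *: x.

Definition is_eigenvector (x : M) : Prop := exists lam, weight_space lam x.

(* The sum of all weight spaces inside M; it is automatically direct.         *)
Definition weight_sum (x : M) : Prop :=
  exists (m : nat) (lam : 'I_m -> torus_char) (y : 'I_m -> M),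
    (forall i, weight_space (lam i) (y i)) /\ x = \sum_i y i.

(* The subspace W has finite dimension n.                                     *)
Definition has_dim (W : M -> Prop) (n : nat) : Prop :=
  exists b : 'I_n -> M,
    [/\ forall i, W (b i),
        forall c : 'I_n -> k, \sum_i c i *: b i = 0 -> forall i, c i = 0
      & forall x, W x -> exists c : 'I_n -> k, x = \sum_i c i *: b i].

(* The subspace kU xi of M.                                                   *)
Definition unipotent_span (xi x : M) : Prop :=
  exists (m : nat) (c : 'I_m -> k) (u : 'I_m -> G),
    (forall i, u i \in unipotent F) /\ x = \sum_i c i *: gact (u i) xi.

(* phi identifies M with the external direct sum of the kU (xi i), viewed as  *)
(* the set of n-tuples of elements of M with i-th entry in kU (xi i) and with *)
(* componentwise operations.                                                  *)
Definition is_kB_iso (n : nat) (xi : 'I_n -> M)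
    (phi : M -> {ffun 'I_n -> M}) : Prop :=
  [/\ linear phi, injective phi,
      forall y, (exists x, phi x = y) <-> (forall i, unipotent_span (xi i) (y i))
    & forall b, b \in borel F -> forall x i, phi (gact b x) i = gact b (phi x i)].

Definition in_catC : Prop :=
  exists n : nat, has_dim weight_sum n /\
    exists xi : 'I_n -> M, (forall i, is_eigenvector (xi i)) /\
      exists phi, is_kB_iso xi phi.

End Module.

Definition catC : precat := @full_subcat (gmod_cat k G) in_catC.

End CategoryC.

(* Main.v *)
Require Import Defs.
From mathcomp Require Import all_boot all_order all_fingroup all_algebra all_field.
From HB Require Import structures.
From mathcomp Require Import boolp ring.
(* The action of a group on a module has the same name as an operation of the
   finite group library; importing again gives it precedence. *)
Import Defs.

Set Implicit Arguments.
Unset Strict Implicit.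
Unset Printing Implicit Defensive.

Import GRing.Theory.
Local Open Scope ring_scope.

(** Write [up x], [lo x], [dg t] and [weyl] for the upper unipotent, lower
    unipotent, diagonal and Weyl elements of SL2.  Everything but kernels is
    formal; the point is that the kernel of a morphism between objects of the
    category is generated, over the upper unipotent group U, by torus
    eigenvectors.

    An object M has a finite dimensional space V of eigenvectors, with a subspace
    W of U-fixed vectors, and M/W is free over kU on V/W.  This description
    ([free_family], equivalent to membership in the category by
    [in_catC_free_family] and [free_family_in_catC]) rests on a dichotomy for
    ideals of the group algebra of the additive group of F that are stable under
    scaling: such an ideal is zero or contains the augmentation ideal
    ([orbit_dichotomy]).  It is proved by summing a relation over the nonzero
    elements of a large finite subfield.

    The decisive fact is that for every v in V the vector
      [omega v = lo 1 v - up 1 (weyl v) - v]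
    lies in W ([omega_up_fixed]).  Since M is a direct sum of translates of V/W
    modulo W, each vector has a finite support in F.  Comparing supports in the
    relation [lo 1 * lo y = lo (1 + y)] for generic y shows that [lo 1 v] is
    supported on {0, 1} ([lo1_support]).  The vectors supported away from 0 form a
    subspace O stable under the opposite Borel subgroup, and M/O is finite
    dimensional; the dichotomy, applied to the lower unipotent group acting on
    M/O, shows that this action is trivial ([lo_trivial_mod_open_cell]), which
    determines the component of [lo 1 v] at 0.  The identity
    [lo 1 = up 1 * weyl * up 1] transports this to the component at 1.

    Let f : M -> N be a morphism and v in V with f v fixed by U.  As
    [lo 1 (f v) = up 1 (weyl (f v))], one gets [f (omega v) = - f v], that is,
    [v + omega v] is in the kernel.  Now if x = sum of [up z (phi z)] is in the
    kernel, freeness of N forces each f (phi z) to be U-fixed, so replacing phi z by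
    [phi z + omega (phi z)] rewrites x in terms of eigenvectors in the kernel
    ([free_family_ker]).  For cokernels the images of the eigenvectors of N work
    directly ([free_family_coker]).  A monomorphism then has zero kernel and an
    epimorphism zero cokernel, and each is the kernel, respectively the cokernel,
    of the obvious map. *)

(** * Spans and linear independence in infinite dimensional spaces *)

Section LinearSpan.
Variables (k : fieldType) (X : lmodType k).
Implicit Types (A L : X -> Prop) (s r : seq X).

Inductive lspan A : X -> Prop :=
| lspan0 : lspan A 0
| lspanZD a x y : A x -> lspan A y -> lspan A (a *: x + y).

Record subspace L : Prop := Subspace {
  subspace0 : L 0;
  subspaceP : forall a x y, L x -> L y -> L (a *: x + y) }.

Lemma subspaceD L x y : subspace L -> L x -> L y -> L (x + y).
Proof. by move=> sL Lx Ly; rewrite -[x]scale1r; apply: subspaceP. Qed.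

Lemma subspaceZ L a x : subspace L -> L x -> L (a *: x).
Proof.
by move=> sL Lx; rewrite -[_ *: _]addr0; apply: subspaceP => //; apply: subspace0.
Qed.

Lemma subspaceN L x : subspace L -> L x -> L (- x).
Proof. by move=> sL Lx; rewrite -scaleN1r; apply: subspaceZ. Qed.

Lemma subspaceB L x y : subspace L -> L x -> L y -> L (x - y).
Proof. by move=> sL Lx Ly; apply: subspaceD => //; apply: subspaceN. Qed.

Lemma subspaceZI L a x : subspace L -> a != 0 -> L (a *: x) -> L x.
Proof.
by move=> sL a0 /(subspaceZ a^-1 sL); rewrite scalerA mulVf // scale1r.
Qed.

Lemma subspace_sum L (I : eqType) (r : seq I) (f : I -> X) :
  subspace L -> (forall i, i \in r -> L (f i)) -> L (\sum_(i <- r) f i).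
Proof.
move=> sL Lf; rewrite big_seq; elim/big_rec: _ => [|i x ir Lx].
  exact: subspace0.
by apply: subspaceD => //; apply: Lf.
Qed.

Lemma subspace_zero : subspace (fun x : X => x = 0).
Proof. by split=> // a x y -> ->; rewrite scaler0 addr0. Qed.

Lemma lspan_subspace A : subspace (lspan A).
Proof.
split=> [|a x y]; first exact: lspan0.
elim=> {x} [|b x z Ax _ IH] Ay; first by rewrite scaler0 add0r.
by rewrite scalerDr scalerA -addrA; apply: lspanZD => //; apply: IH.
Qed.

Lemma lspan_incl A x : A x -> lspan A x.
Proof.
by move=> Ax; rewrite -[x]addr0 -[x]scale1r; apply: lspanZD => //; apply: lspan0.
Qed.

Lemma lspan_min A L : subspace L -> (forall x, A x -> L x) ->
  forall x, lspan A x -> L x.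
Proof.
move=> sL AL x; elim=> {x} [|a x y Ax _ Ly]; first exact: subspace0.
by apply: subspaceP => //; apply: AL.
Qed.

Lemma lspan_mono A B : (forall x, A x -> B x) -> forall x, lspan A x -> lspan B x.
Proof.
move=> AB; apply: lspan_min; first exact: lspan_subspace.
by move=> x Ax; apply: lspan_incl; apply: AB.
Qed.

(** Collecting terms: a vector in the span of a union of subspaces is a sum with one
    term for each index.  It serves both for the decomposition of a vector into
    weight components and for its decomposition into translates by U. *)
Lemma lspan_normal (I : eqType) (P : I -> Prop) (A : I -> X -> Prop) x :
    (forall i, subspace (A i)) -> lspan (fun y => exists2 i, P i & A i y) x ->
  exists S (phi : I -> X), [/\ uniq S, forall i, i \in S -> P i,
    forall i, A i (phi i) & x = \sum_(i <- S) phi i].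
Proof.
move=> sA; elim=> {x} [|a x y [i Pi Aix] _ [S [phi [uS PS Aphi ->]]]].
  exists [::], (fun=> 0); split=> //; last by rewrite big_nil.
  by move=> i; apply: subspace0.
pose phi' j := if j == i then a *: x + (if i \in S then phi i else 0) else phi j.
have Aphi' j : A j (phi' j).
  rewrite /phi'; case: eqP => [->|//]; apply: subspaceP => //.
  by case: ifP => _ //; apply: subspace0.
have phi'i : phi' i = a *: x + (if i \in S then phi i else 0) by rewrite /phi' eqxx.
have sum' (T : seq I) : i \notin T -> \sum_(j <- T) phi' j = \sum_(j <- T) phi j.
  move=> iT; apply: eq_big_seq => j jT; rewrite /phi'; case: eqP => // eji.
  by rewrite eji (negbTE iT) in jT.
case iS: (i \in S).
  exists S, phi'; split=> //.
  rewrite (bigD1_seq i) // [RHS](bigD1_seq i) //= phi'i iS addrA.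
  by congr (_ + _); apply: eq_bigr => j ji; rewrite /phi' (negbTE ji).
exists (i :: S), phi'; split=> //=; first by rewrite iS.
  by move=> j; rewrite inE => /predU1P[->|/PS].
by rewrite big_cons sum' ?iS // phi'i iS addr0.
Qed.

Definition indep s := forall c : nat -> k,
  \sum_(i < size s) c i *: s`_i = 0 -> forall i, (i < size s)%N -> c i = 0.

Lemma lspan_seqP s x :
  lspan (fun y => y \in s) x -> exists c : nat -> k, x = \sum_(i < size s) c i *: s`_i.
Proof.
elim=> {x} [|a x y xs _ [c ->]].
  by exists (fun=> 0); rewrite big1 // => i _; rewrite scale0r.
exists (fun i => (if i == index x s then a else 0) + c i).
rewrite [RHS](eq_bigr (fun i : 'I_(size s) =>
  (if i == index x s :> nat then a else 0) *: s`_i + c i *: s`_i)); last first.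
  by move=> i _; rewrite scalerDl.
rewrite big_split /=; congr (_ + _).
have ixs : (index x s < size s)%N by rewrite index_mem.
rewrite (bigD1 (Ordinal ixs)) //= eqxx nth_index // big1 ?addr0 // => i ne.
by case: ifP => [/eqP e|_]; rewrite ?scale0r //; case/eqP: ne; apply: val_inj.
Qed.

Lemma lspan_sum_seq s (c : nat -> k) :
  lspan (fun y => y \in s) (\sum_(i < size s) c i *: s`_i).
Proof.
apply: (subspace_sum (lspan_subspace _)) => i _.
by apply: subspaceZ; [exact: lspan_subspace | apply: lspan_incl; apply: mem_nth].
Qed.

(** Working modulo a subspace L serves twice: with L = 0 it bounds the size of
    independent families, and with L of finite codimension it makes an infinite
    orbit dependent modulo L. *)
Lemma dependent_mod L s m (y : 'I_m -> X) : subspace L -> (size s < m)%N ->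
    (forall i, exists2 v, lspan (fun z => z \in s) v & L (y i - v)) ->
  exists c : 'I_m -> k, (exists i, c i != 0) /\ L (\sum_i c i *: y i).
Proof.
move=> sL sm H.
have {H} H i : exists c : nat -> k, L (y i - \sum_(j < size s) c j *: s`_j).
  by have [v /lspan_seqP[c ->] Lv] := H i; exists c.
have [c Hc] := choice H.
pose A := \matrix_(i < m, j < size s) c i j.
have : kermx A != 0.
  rewrite -mxrank_eq0 mxrank_ker -lt0n subn_gt0.
  by apply: leq_ltn_trans sm; apply: rank_leq_col.
case/rowV0Pn => d dA d0.
have {}dA : d *m A = 0 by apply/sub_kermxP.
exists (fun i => d 0 i); split.
  by case/rV0Pn: d0 => i di; exists i.
have -> : \sum_i d 0 i *: y i =
    \sum_i d 0 i *: (y i - \sum_(j < size s) c i j *: s`_j).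
  rewrite [RHS](eq_bigr (fun i => d 0 i *: y i
    - d 0 i *: \sum_(j < size s) c i j *: s`_j)); last first.
    by move=> i _; rewrite scalerBr.
  rewrite sumrB (_ : \sum_i d 0 i *: (\sum_(j < size s) c i j *: s`_j) = 0) ?subr0 //.
  rewrite (eq_bigr (fun i => \sum_(j < size s) (d 0 i * A i j) *: s`_j)); last first.
    by move=> i _; rewrite scaler_sumr; apply: eq_bigr => j _; rewrite scalerA mxE.
  rewrite exchange_big big1 // => j _; rewrite -scaler_suml.
  by have /matrixP/(_ 0 j) := dA; rewrite !mxE => ->; rewrite scale0r.
by apply: subspace_sum => // i _; apply: subspaceZ.
Qed.

Lemma indep_size s r : indep r -> (forall x, x \in r -> lspan (fun y => y \in s) x) ->
  (size r <= size s)%N.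
Proof.
move=> ir rs; rewrite leqNgt; apply/negP => lt_sr.
have [|c [[i ci] /= c0]] := @dependent_mod _ s (size r) (fun i => r`_i) subspace_zero lt_sr.
  by move=> i; exists r`_i; [apply: rs; apply: mem_nth | rewrite subrr].
pose d j := oapp c 0 (insub j).
case/eqP: ci; rewrite -[RHS](ir d _ i) ?ltn_ord //; last first.
  rewrite -[RHS]c0; apply: eq_bigr => j _; congr (_ *: _).
  by rewrite /d valK.
by rewrite /d valK.
Qed.

Lemma indep_rcons r x : indep r -> ~ lspan (fun y => y \in r) x -> indep (rcons r x).
Proof.
move=> ir nx c; rewrite size_rcons big_ord_recr /= nth_rcons ltnn eqxx.
rewrite (eq_bigr (fun i : 'I_(size r) => c i *: r`_i)); last first.
  by move=> i _; rewrite nth_rcons ltn_ord.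
have [cx|cx] := eqVneq (c (size r)) 0.
  rewrite cx scale0r addr0 => /ir ci i; rewrite ltnS leq_eqVlt.
  by case/predU1P => [->|/ci].
move=> e; case: nx.
apply: (subspaceZI (lspan_subspace _) cx).
rewrite (_ : _ *: x = - \sum_(i < size r) c i *: r`_i); last first.
  by apply/eqP; rewrite -addr_eq0 addrC e.
exact: (subspaceN (lspan_subspace _) (lspan_sum_seq _ _)).
Qed.

(** The new vectors are taken from E itself and not from its span: this is how bases
    made of eigenvectors are produced. *)
Lemma indep_extend (E : X -> Prop) s r :
    (forall x, E x -> lspan (fun y => y \in s) x) ->
    (forall x, x \in r -> lspan (fun y => y \in s) x) -> indep r ->
  exists r', [/\ forall x, x \in r' -> E x, indep (r ++ r')
    & forall x, E x -> lspan (fun y => y \in r ++ r') x].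
Proof.
move=> Es; move: {2}(size s - size r)%N (leqnn (size s - size r)%N) => m.
elim: m r => [|m IH] r le_m rs ir; have le_rs := indep_size ir rs;
  have [[x Ex nx]|all_r] := pselect (exists2 x, E x & ~ lspan (fun y => y \in r) x).
- have /indep_size : indep (rcons r x) by apply: indep_rcons.
  move=> /(_ s); rewrite size_rcons ltnNge -subn_eq0 -leqn0 le_m => H.
  have // : false by apply: H => y; rewrite mem_rcons inE => /predU1P[->|/rs//]; apply: Es.
- exists [::]; rewrite cats0; split=> // x Ex.
  by apply: contrapT => nx; case: all_r; exists x.
- have ir' : indep (rcons r x) by apply: indep_rcons.
  have [||//|r' [r'E ir'' Er']] := IH (rcons r x).
  + by rewrite size_rcons subnS; case: (size s - size r)%N le_m.
  + by move=> y; rewrite mem_rcons inE => /predU1P[->|/rs//]; apply: Es.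
  exists (x :: r'); rewrite -cat_rcons; split=> // y.
  by rewrite inE => /predU1P[->|/r'E].
- exists [::]; rewrite cats0; split=> // x Ex.
  by apply: contrapT => nx; case: all_r; exists x.
Qed.

End LinearSpan.

Lemma subspace_preim (k : fieldType) (X Y : lmodType k) (f : X -> Y) L :
  linear f -> subspace L -> subspace (fun x => L (f x)).
Proof.
move=> lf sL; split=> [|a x y Lx Ly]; last by rewrite lf; apply: subspaceP.
have -> : f 0 = 0; last by apply: subspace0.
by have := lf (-1) 0 0; rewrite scaler0 addr0 scaleN1r addNr.
Qed.

Lemma lspan_image (k : fieldType) (X Y : lmodType k) (f : X -> Y) A L :
  linear f -> subspace L -> (forall x, A x -> L (f x)) ->
  forall x, lspan A x -> L (f x).
Proof. by move=> lf sL AL; apply: lspan_min => //; apply: subspace_preim. Qed.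

(** * Finite subfields and the dichotomy for scaling-stable relations *)

Lemma closed_field_sqrt (F : closedFieldType) (a : F) :
  a != 0 -> exists2 t, t != 0 & t ^+ 2 = a.
Proof.
move=> a0; have [t] := @solve_monicpoly F 2 (fun i => if i == 0%N then a else 0) isT.
rewrite !big_ord_recl big_ord0 /= expr0 mulr1 mul0r !addr0 => t2; exists t => //.
by apply: contra_neq a0 => t0; rewrite -t2 t0 expr0n.
Qed.

(** Supplies elements of F in general position. *)
Lemma closed_field_avoid (F : closedFieldType) (ps : seq {poly F}) :
  (forall p, p \in ps -> p != 0) -> exists y, forall p, p \in ps -> p.[y] != 0.
Proof.
move=> ps0; have /closed_nonrootP[y] : (\prod_(p <- ps) p : {poly F}) != 0.
  by rewrite prodf_seq_neq0; apply/allP => p /ps0 ->.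
rewrite /root horner_prod prodf_seq_neq0 => /allP H.
by exists y => p /H.
Qed.

Section FiniteSubfields.
Variables (F : closedFieldType) (p : nat).
Hypothesis pcF : p \in [pchar F].

Let p_pr : prime p. Proof. exact: pcharf_prime pcF. Qed.

Lemma frobenius_additive m (x y : F) : (x + y) ^+ (p ^ m) = x ^+ (p ^ m) + y ^+ (p ^ m).
Proof.
by apply: exprDn_pchar; rewrite pnatX (eq_pnat _ (pcharf_eq pcF)) pnat_id.
Qed.

Lemma frobenius_inj m : injective (fun x : F => x ^+ (p ^ m)).
Proof.
move=> x y /= exy; apply/eqP; rewrite -subr_eq0.
have : (x - y) ^+ (p ^ m) == 0.
  have := frobenius_additive m (x - y) y; rewrite subrK exy => /eqP.
  by rewrite -subr_eq subrr eq_sym.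
by rewrite expf_eq0 => /andP[].
Qed.

Lemma frobenius_fixed_mul m j (x : F) : x ^+ (p ^ m) = x -> x ^+ (p ^ (m * j)) = x.
Proof.
move=> fx; elim: j => [|j IH]; first by rewrite muln0 expr1.
by rewrite mulnS expnD exprM fx.
Qed.

(** The powers of x are values of polynomials of bounded degree over the finite
    field, so two iterates of Frobenius agree at x; Frobenius is injective. *)
Lemma algebraic_frobenius_fixed (Fq : finFieldType) (iota : {rmorphism Fq -> F}) x :
  algebraicOver iota x -> exists2 m, (0 < m)%N & x ^+ (p ^ m) = x.
Proof.
move=> [P P0 Px].
have evalP i : x ^+ i = (map_poly iota ('X^i %% P)).[x].
  rewrite -[LHS](@hornerXn F) -(map_polyXn iota) {1}(divp_eq 'X^i P).
  by rewrite rmorphD rmorphM /= hornerD hornerM (rootP Px) mulr0 add0r.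
pose T := 'rV[Fq]_(size P).
pose g (i : 'I_#|T|.+1) : T := poly_rV ('X^(p ^ i) %% P).
have /injectivePn[i [j ij eg]] : ~~ injectiveb g.
  by apply/negP => /injectiveP /leq_card; rewrite card_ord ltnn.
have e : x ^+ (p ^ i) = x ^+ (p ^ j).
  rewrite evalP [RHS]evalP; congr (map_poly _ _).[_].
  have sP n : (size ('X^n %% P)%R <= size P)%N by rewrite ltnW ?ltn_modp.
  by rewrite -(poly_rV_K (sP (p ^ i)%N)) [poly_rV _]eg poly_rV_K.
wlog lt_ij : i j ij {eg} e / (i < j)%N.
  move=> W; case: (ltngtP i j) => [|/(W j i)|/val_inj eij]; first exact: W.
    by rewrite eq_sym; apply.
  by rewrite eij eqxx in ij.
exists (j - i)%N; first by rewrite subn_gt0.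
by apply: (@frobenius_inj i); rewrite -exprM -expnD subnK 1?ltnW.
Qed.

Lemma frobenius_fixed_seq (xs : seq F) :
    (forall x : F, exists2 m, (0 < m)%N & x ^+ (p ^ m) = x) ->
  exists2 m, (0 < m)%N & forall x, x \in xs -> x ^+ (p ^ m) = x.
Proof.
move=> alg; elim: xs => [|x xs [m m0 IH]]; first by exists 1%N.
have [n n0 xn] := alg x; exists (m * n)%N; first by rewrite muln_gt0 m0.
move=> y; rewrite inE => /predU1P[->|/IH]; last exact: frobenius_fixed_mul.
by rewrite mulnC; apply: frobenius_fixed_mul.
Qed.

Lemma frobenius_fixed_enum m : (0 < m)%N -> exists R : seq F,
  [/\ uniq R, size R = (p ^ m)%N & forall x, (x \in R) = (x ^+ (p ^ m) == x)].
Proof.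
move=> m0; set Q := (p ^ m)%N.
have Q1 : (1 < Q)%N by rewrite -(exp1n m) ltn_exp2r // prime_gt1.
pose f : {poly F} := 'X^Q - 'X.
have sf : size f = Q.+1 by rewrite size_polyDl ?size_polyN ?size_polyX size_polyXn ?ltnS.
have lf : lead_coef f = 1.
  by rewrite lead_coefDl ?lead_coefXn // size_polyN size_polyX size_polyXn ltnS.
have f' : f^`() = - 1.
  rewrite derivB derivXn derivX -mulr_natr -polyC_natr natrX.
  rewrite (_ : p%:R = 0 :> F) ?expr0n ?gtn_eqF //= ?polyC0 ?mulr0 ?sub0r //.
  exact: pcharf0.
have [R eR] := closed_field_poly_normal f.
rewrite lf scale1r in eR.
exists R; split.
- rewrite -separable_prod_XsubC -eR unlock f' -scaleN1r coprimepZr ?oppr_eq0 ?oner_eq0 //.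
  exact: coprimep1.
- by have := size_prod_XsubC R id; rewrite -eR sf => -[].
- by move=> x; rewrite -root_prod_XsubC -eR rootE !hornerE subr_eq0.
Qed.

End FiniteSubfields.

Section Dichotomy.
Variables (F : closedFieldType) (p : nat).
Hypothesis pcF : p \in [pchar F].
Hypothesis alg : forall x : F, exists2 m, (0 < m)%N & x ^+ (p ^ m) = x.
Variables (k : fieldType) (X : lmodType k) (L : X -> Prop) (e : F -> X).
Hypothesis char0 : [pchar k] =i pred0.
Hypothesis sL : subspace L.
Hypothesis affL : forall (l : seq (k * F)) t z, t != 0 ->
  L (\sum_(i <- l) i.1 *: e i.2) -> L (\sum_(i <- l) i.1 *: e (t * i.2 + z)).

(** A relation expressing e 0 through the other values e y makes e constant modulo L.
    With Q the size of a finite subfield R containing all the scalars in play, C the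
    sum of the coefficients and N the sum of e over R, adding up the relation
    scaled by all nonzero t in R and translated by z gives
    [(Q - 1 + C) *: e z - C *: N] in L.  As N does not depend on z, subtracting the
    cases z = x and z = 0 leaves [(Q - 1 + C) *: (e x - e 0)]. *)
Lemma orbit_dichotomy (l : seq (k * F)) : (forall i, i \in l -> i.2 != 0) ->
  L (e 0 - \sum_(i <- l) i.1 *: e i.2) -> forall x, L (e x - e 0).
Proof.
move=> l0 Ll x; pose C := \sum_(i <- l) i.1.
have p_pr := pcharf_prime pcF.
have [m m0 fixm] := frobenius_fixed_seq (x :: map snd l) alg.
(* In characteristic 0 the factor Q - 1 + C cannot vanish for both Q and Q ^ 2. *)
wlog Qm : m m0 fixm / (p ^ m)%:R - 1 + C != 0.
  move=> W; have [Q0|] := eqVneq ((p ^ m)%:R - 1 + C) 0; last exact: W m0 fixm.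
  apply: (W (m * 2)%N); first by rewrite muln_gt0 m0.
    by move=> y /fixm; apply: frobenius_fixed_mul.
  apply/eqP => Q0'; have /eqP : (p ^ (m * 2))%:R = (p ^ m)%:R :> k.
    by apply: (addIr (- 1 + C)); rewrite !addrA Q0'.
  rewrite expnM -mulnn natrM -subr_eq0 -[X in _ - X]mulr1 -mulrBr.
  have pn0 n : (0 < n)%N -> n%:R != 0 :> k by rewrite lt0n; move/pcharf0P: char0 => ->.
  rewrite mulf_eq0 (negbTE (pn0 _ _)) ?expn_gt0 ?prime_gt0 //=.
  rewrite -(natrB _ (n := 1)) ?expn_gt0 ?prime_gt0 // (negbTE (pn0 _ _)) //.
  by rewrite subn_gt0 -(exp1n m) ltn_exp2r // prime_gt1.
have [R [uR sR memR]] := frobenius_fixed_enum pcF m0.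
have R0 : 0 \in R by rewrite memR expr0n expn_eq0 (gtn_eqF (prime_gt0 _)).
have RD y z : y \in R -> z \in R -> y + z \in R.
  by rewrite !memR frobenius_additive // => /eqP -> /eqP ->.
have RM y z : y \in R -> z \in R -> y * z \in R.
  by rewrite !memR exprMn => /eqP -> /eqP ->.
have xR : x \in R by rewrite memR fixm ?mem_head.
have lR i : i \in l -> i.2 \in R.
  by move=> il; rewrite memR fixm // inE map_f ?orbT.
pose N := \sum_(y <- R) e y.
have perm_sum f : injective f -> (forall y, y \in R -> f y \in R) ->
    \sum_(y <- R) e (f y) = N.
  move=> fi fR; rewrite -(big_map f xpredT e); apply: perm_big.
  apply: uniq_perm; rewrite ?map_inj_uniq //.
  have sub : {subset map f R <= R} by move=> _ /mapP[y yR ->]; apply: fR.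
  have [||//] := uniq_min_size _ sub; by rewrite ?map_inj_uniq ?size_map.
have sum_nz f : \sum_(t <- R | t != 0) f t = \sum_(t <- R) f t - f 0 :> X.
  by rewrite [X in _ = X - _](bigD1_seq 0) //= [f 0 + _]addrC addrK.
have sumN (g : F -> X) : \sum_(i <- l) - i.1 *: g i.2 = - \sum_(i <- l) i.1 *: g i.2.
  by rewrite -sumrN; apply: eq_bigr => i _; rewrite scaleNr.
have key z : z \in R -> L (((p ^ m)%:R - 1 + C) *: e z - C *: N).
  move=> zR.
  have -> : ((p ^ m)%:R - 1 + C) *: e z - C *: N =
      \sum_(t <- R | t != 0) (e z - \sum_(i <- l) i.1 *: e (t * i.2 + z)).
    rewrite sumrB exchange_big /= sum_nz.
    rewrite [\sum_(i <- R) e z]big_const_seq count_predT sR iter_addr_0.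
    rewrite (eq_big_seq (fun i => i.1 *: (N - e z))); last first.
      move=> i il; rewrite -scaler_sumr sum_nz mul0r add0r; congr (_ *: (_ - _)).
      apply: (perm_sum (fun t => t * i.2 + z)).
        by move=> a b /addIr /(mulIf (l0 i il)).
      by move=> y yR; apply: RD => //; apply: RM => //; apply: lR.
    rewrite -scaler_suml -/C scalerDl scalerBl scale1r scalerBr scaler_nat.
    by rewrite opprB !addrA.
  rewrite -big_filter; apply: subspace_sum => // t; rewrite mem_filter => /andP[t0 _].
  have := affL (l := (1, 0) :: [seq (- i.1, i.2) | i <- l]) z t0.
  rewrite !big_cons !big_map /= !scale1r mulr0 add0r.
  by rewrite (sumN e) (sumN (fun y => e (t * y + z))); apply.
apply: (subspaceZI sL Qm).
have := subspaceB sL (key x xR) (key 0 R0).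
by rewrite opprB addrA subrK -scalerBr.
Qed.

End Dichotomy.

(** * Elements of SL2 *)

Section SL2Elements.
Variable F : fieldType.
Local Notation G := (SL2 F).
Implicit Types a b c d t x y : F.

Definition mx2 a b c d : 'M[F]_2 := \matrix_(i, j)
  if i == 0 then if j == 0 then a else b else if j == 0 then c else d.

Lemma mx2_eta (A : 'M[F]_2) : A = mx2 (A 0 0) (A 0 1) (A 1 0) (A 1 1).
Proof.
apply/matrixP => i j; rewrite mxE.
by case: i => [[|[|//]] ?]; case: j => [[|[|//]] ?] /=; congr (A _ _); apply: val_inj.
Qed.

Lemma det_mx2 a b c d : \det (mx2 a b c d) = a * d - b * c.
Proof.
rewrite (expand_det_row _ 0) !big_ord_recl big_ord0 /cofactor !det_mx11 !mxE /=.
by rewrite expr0 expr1 mul1r addr0 mulN1r mulrN.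
Qed.

(** The identity matrix stands in when the determinant is not 1; in particular
    [dg 0] below is the identity, so that weights can be total functions on F. *)
Definition sl2 a b c d : G := insubd (sl2_one F) (mx2 a b c d).

Lemma val_sl2 a b c d : a * d - b * c = 1 -> sl2 a b c d = mx2 a b c d :> 'M_2.
Proof. by move=> e; apply: insubdK; rewrite unfold_in det_mx2 e. Qed.

Lemma sl2M a b c d a' b' c' d' : a * d - b * c = 1 -> a' * d' - b' * c' = 1 ->
  (sl2 a b c d * sl2 a' b' c' d')%g =
  sl2 (a * a' + b * c') (a * b' + b * d') (c * a' + d * c') (c * b' + d * d').
Proof.
move=> e e'; apply: val_inj; rewrite /= !val_sl2 //.
  by rewrite [LHS]mx2_eta !mxE !big_ord_recl !big_ord0 !mxE /= !addr0.
by rewrite -[1]mulr1 -{1}e -e'; ring.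
Qed.

Definition up x := sl2 1 x 0 1.
Definition lo x := sl2 1 0 x 1.
Definition dg t := sl2 t 0 0 t^-1.
Definition weyl := sl2 0 (-1) 1 0.

Ltac field_nz := field; do ?[apply/andP; split]; rewrite ?oner_neq0 //.

Lemma up0 : up 0 = 1%g.
Proof.
apply: val_inj; rewrite /= val_sl2; last by ring.
by rewrite [RHS]mx2_eta !mxE.
Qed.

Lemma upD x y : (up x * up y)%g = up (x + y).
Proof. by rewrite /up sl2M; [congr sl2; ring | ring | ring]. Qed.

Lemma lo0 : lo 0 = 1%g.
Proof.
apply: val_inj; rewrite /= val_sl2; last by ring.
by rewrite [RHS]mx2_eta !mxE.
Qed.

Lemma loD x y : (lo x * lo y)%g = lo (x + y).
Proof. by rewrite /lo sl2M; [congr sl2; ring | ring | ring]. Qed.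

Lemma dg_up t x : t != 0 -> (dg t * up x)%g = (up (t ^+ 2 * x) * dg t)%g.
Proof. by move=> t0; rewrite /up /dg !sl2M; [congr sl2; field_nz | field_nz..]. Qed.

Lemma dg_lo t x : t != 0 -> (dg t * lo x)%g = (lo (x / t ^+ 2) * dg t)%g.
Proof. by move=> t0; rewrite /lo /dg !sl2M; [congr sl2; field_nz | field_nz..]. Qed.

Lemma dgV t : t != 0 -> (dg t * dg t^-1)%g = 1%g.
Proof.
move=> t0; rewrite -up0 /up /dg !sl2M; [congr sl2; field_nz | field_nz..].
Qed.

(** Rewrites a lower unipotent acting on the translate by [up y] as a move of the
    position y, followed by the opposite Borel subgroup. *)
Lemma lo_up x y : 1 + x * y != 0 ->
  (lo x * up y)%g = (up (y / (1 + x * y)) * dg (1 + x * y)^-1 * lo (x / (1 + x * y)))%g.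
Proof.
move=> t0; rewrite /up /lo /dg !sl2M; [congr sl2; field_nz | field_nz..].
Qed.

(** The exceptional position [- x^-1], which [lo x] moves to infinity. *)
Lemma lo_up_weyl x : x != 0 ->
  (lo x * up (- x^-1))%g = (up x^-1 * weyl * dg x)%g.
Proof.
move=> t0; rewrite /up /lo /dg /weyl !sl2M; [congr sl2; field_nz | field_nz..].
Qed.

Lemma lo1 : lo 1 = (up 1 * weyl * up 1)%g.
Proof. by rewrite /up /lo /weyl !sl2M; [congr sl2; ring | ring..]. Qed.

Lemma weyl_lo : (weyl * lo 1)%g = (up (-1) * weyl)%g.
Proof. by rewrite /up /lo /weyl !sl2M; [congr sl2; ring | ring..]. Qed.

Lemma weyl4 : (weyl * (weyl * (weyl * weyl)))%g = 1%g.
Proof. by rewrite -up0 /up /weyl !sl2M; [congr sl2; ring | ring..]. Qed.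

Lemma dg_weyl t : t != 0 -> (dg t * weyl)%g = (weyl * dg t^-1)%g.
Proof.
move=> t0; rewrite /dg /weyl !sl2M; [congr sl2; field_nz | field_nz..].
Qed.

Lemma torusE (g : G) : reflect (exists2 t, t != 0 & g = dg t) (g \in torus F).
Proof.
apply: (iffP idP) => [|[t t0 ->]]; last first.
  rewrite /torus unfold_in; apply/is_diag_mxP => i j ij.
  rewrite val_sl2 ?mxE; last by field_nz.
  by case: i j ij => [[|[|//]] ?] [[|[|//]] ?].
rewrite /torus unfold_in => /is_diag_mxP gd.
have g01 : (g : 'M_2) 0 1 = 0 by apply: gd.
have g10 : (g : 'M_2) 1 0 = 0 by apply: gd.
have : \det g = 1 by apply/eqP; exact: sl2_det.
rewrite {1}[sl2val g]mx2_eta det_mx2 g01 mul0r subr0 => e.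
have t0 : (g : 'M_2) 0 0 != 0.
  by apply/eqP => z; move/eqP: e; rewrite z mul0r eq_sym oner_eq0.
exists ((g : 'M_2) 0 0) => //; apply: val_inj; rewrite /= val_sl2; last by field_nz.
rewrite [LHS]mx2_eta g01 g10; congr mx2.
by rewrite -[LHS](mulKf t0) e mulr1.
Qed.

Lemma unipotentE (g : G) : reflect (exists x, g = up x) (g \in unipotent F).
Proof.
apply: (iffP idP) => [|[x ->]]; last first.
  by rewrite /unipotent unfold_in val_sl2 ?mxE /= ?eqxx //; ring.
rewrite /unipotent unfold_in => /and3P[/eqP g10 /eqP g00 /eqP g11].
exists ((g : 'M_2) 0 1); apply: val_inj; rewrite /= val_sl2; last by ring.
by rewrite [LHS]mx2_eta g10 g00 g11.
Qed.

Lemma borelE (g : G) :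
  reflect (exists2 t, t != 0 & exists x, g = (up x * dg t)%g) (g \in borel F).
Proof.
apply: (iffP idP) => [|[t t0 [x ->]]]; last first.
  rewrite /borel unfold_in /up /dg sl2M ?val_sl2 ?mxE /=; try by field_nz.
  by rewrite !mul0r mulr0 addr0.
rewrite /borel unfold_in => /eqP g10.
have : \det g = 1 by apply/eqP; exact: sl2_det.
rewrite {1}[sl2val g]mx2_eta det_mx2 g10 mulr0 subr0 => e.
have t0 : (g : 'M_2) 0 0 != 0.
  by apply/eqP => z; move/eqP: e; rewrite z mul0r eq_sym oner_eq0.
have e11 : (g : 'M_2) 1 1 = ((g : 'M_2) 0 0)^-1 by rewrite -[LHS](mulKf t0) e mulr1.
exists ((g : 'M_2) 0 0) => //; exists ((g : 'M_2) 0 1 * (g : 'M_2) 0 0).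
apply: val_inj; rewrite /up /dg sl2M /=; try by field_nz.
rewrite val_sl2; last by field_nz.
rewrite [LHS]mx2_eta g10 e11; congr mx2; field_nz.
Qed.

End SL2Elements.

(** * Torus eigenvectors *)

Section Eigenvectors.
Variables (F k : fieldType) (M : gmod k (SL2 F)).
Implicit Types (v m : M) (t x : F) (lam : F -> k).

Definition has_weight lam v := forall t, gact (dg t) v = lam t *: v.

Lemma has_weight_subspace lam : subspace (has_weight lam).
Proof.
split=> [t|a x y wx wy t]; first by rewrite linear0 scaler0.
by rewrite linearP /= wx wy scalerDr !scalerA mulrC.
Qed.

Lemma dg0 : dg (0 : F) = 1%g.
Proof.
apply: val_inj; rewrite /dg /sl2 /insubd insubF //.
by rewrite det_mx2 !mul0r subr0 eq_sym oner_eq0.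
Qed.

Lemma dg1 : dg (1 : F) = 1%g.
Proof.
apply: val_inj; rewrite /= val_sl2; last by rewrite mul1r invr1 mul0r subr0.
by rewrite [RHS]mx2_eta !mxE /= invr1.
Qed.

Lemma dg_actK t v : t != 0 -> gact (dg t) (gact (dg t^-1) v) = v.
Proof. by move=> t0; rewrite -gactM dgV // gact1. Qed.

Lemma has_weight_neq0 lam v t : v != 0 -> has_weight lam v -> lam t != 0.
Proof.
move=> v0 wv; apply: contra_neq v0 => l0.
have [t0|t0] := eqVneq t 0; first by rewrite -[v]gact1 -dg0 -t0 wv l0 scale0r.
by rewrite -(dg_actK v t0) wv linearZ /= wv l0 scale0r scaler0.
Qed.

(** Trades characters of the torus for plain functions of the parameter t; their
    multiplicativity is automatic on a nonzero eigenvector. *)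
Lemma eigenvectorP v : is_eigenvector v <-> exists lam, has_weight lam v.
Proof.
split=> [[chi cv]|[lam wv]].
  have dgT t : t != 0 -> dg t \in torus F by move=> t0; apply/torusE; exists t.
  suff H t : exists a, gact (dg t) v = a *: v.
    by have [lam wv] := choice H; exists lam.
  have [->|t0] := eqVneq t 0; first by exists 1; rewrite dg0 gact1 scale1r.
  by exists (chi (exist _ (dg t) (dgT t t0))); apply: (cv (exist _ (dg t) _)).
have [->|v0] := eqVneq v 0.
  have one0 (t : {t : SL2 F | t \in torus F}) : (1 : k) != 0 by apply: oner_neq0.
  have oneM (s t : {t : SL2 F | t \in torus F}) : (1 : k) = 1 * 1 by rewrite mul1r.
  by exists (TorusChar one0 oneM) => t; rewrite linear0 scaler0.
pose chi (t : {t : SL2 F | t \in torus F}) := lam ((sval t : 'M_2) 0 0).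
have chiE (h : {t : SL2 F | t \in torus F}) : gact (sval h) v = chi h *: v.
  rewrite /chi; case: h => t tT /=; have [a a0 ->] := torusE _ tT.
  by rewrite wv val_sl2 ?mxE //= mul0r subr0 mulfV.
have chi0 (h : {t : SL2 F | t \in torus F}) : chi h != 0 by apply: has_weight_neq0 v0 wv.
have chiM (s t : {t : SL2 F | t \in torus F}) :
    chi (exist _ (val s * val t)%g (torusM (valP s) (valP t))) = chi s * chi t.
  apply/eqP; rewrite -subr_eq0; apply: contraNT v0 => nz.
  rewrite -[v]scale1r -(mulVf nz) -scalerA scalerBl -chiE /= gactM !chiE.
  by rewrite linearZ /= chiE scalerA [chi t * _]mulrC subrr scaler0.
by exists (TorusChar chi0 chiM).
Qed.

Lemma eigenvector_dg v t : is_eigenvector v -> exists a, gact (dg t) v = a *: v.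
Proof. by move=> /eigenvectorP[lam wv]; exists (lam t). Qed.

Lemma eigenvector_weyl v : is_eigenvector v -> is_eigenvector (gact (weyl F) v).
Proof.
move=> /eigenvectorP[lam wv]; apply/eigenvectorP; exists (fun t => lam t^-1) => t.
have [->|t0] := eqVneq t 0.
  by rewrite invr0 dg0 gact1 -linearZ /= -wv dg0 gact1.
by rewrite -gactM dg_weyl // gactM wv linearZ.
Qed.

(** Independence of characters: subtracting [lam t] times the vector from its image
    under [dg t] kills the component of weight lam, and scales that of weight mu by
    [mu t - lam t], which is nonzero for a suitable t. *)
Lemma weight_components (L : M -> Prop) v :
    subspace L -> (forall t m, L m -> L (gact (dg t) m)) ->
    lspan (@is_eigenvector F k M) v -> L v ->
  lspan (fun m => is_eigenvector m /\ L m) v.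
Proof.
move=> sL TL Hv Lv.
have : lspan (fun m => exists2 lam : F -> k, True & has_weight lam m) v.
  by apply: lspan_mono Hv => x /eigenvectorP[lam]; exists lam.
case/(lspan_normal has_weight_subspace) => S [phi [uS _ wphi def_v]].
have {Hv} : L (\sum_(lam <- S) phi lam) -> forall lam, lam \in S -> L (phi lam).
  move: wphi uS; clear -sL TL; elim: S phi => [|lam S IH] phi wphi //= /andP[lamS uS] Lsum.
  suff LS mu : mu \in S -> L (phi mu).
    move=> mu; rewrite inE => /predU1P[->|/LS//].
    rewrite -[phi lam](addrK (\sum_(mu <- S) phi mu)).
    by rewrite big_cons in Lsum; apply: subspaceB => //; apply: subspace_sum.
  move=> muS; have [t ne_t] : exists t, mu t <> lam t.
    apply: contrapT => same; case/negP: lamS; suff -> : lam = mu by [].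
    by apply/funext => t; apply: contrapT => ne; apply: same; exists t => /esym.
  apply: (subspaceZI sL (a := mu t - lam t)); first by rewrite subr_eq0; apply/eqP.
  apply: (IH (fun nu => (nu t - lam t) *: phi nu)) => // [nu|].
    exact: (subspaceZ _ (has_weight_subspace nu) (wphi nu)).
  rewrite (_ : \sum_(nu <- S) _ = gact (dg t) (\sum_(nu <- lam :: S) phi nu)
     - lam t *: \sum_(nu <- lam :: S) phi nu); last first.
    rewrite linear_sum scaler_sumr -sumrB big_cons /= wphi subrr add0r.
    by apply: eq_bigr => nu _; rewrite /= wphi scalerBl.
  by apply: subspaceB => //; [apply: TL | apply: subspaceZ].
rewrite -def_v => /(_ Lv) Lphi; rewrite def_v.
apply: (subspace_sum (lspan_subspace _)) => lam lS; apply: lspan_incl.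
by split; [apply/eigenvectorP; exists lam | apply: Lphi].
Qed.

End Eigenvectors.

Local Notation span s := (lspan (fun y => y \in s)).

(** * Supports of vectors and free families of eigenvectors *)

Section Supports.
Variables (F : closedFieldType) (k : fieldType) (M : gmod k (SL2 F)).
Implicit Types (v m : M) (t x : F) (s : seq M) (P Q : F -> Prop).

Definition translates s x m := exists2 v, span s v & m = gact (up x) v.

(** The vectors with support in P, a set of positions in the affine line F, when s
    spans the eigenvectors.  A U-fixed vector of the span has every nonempty
    support. *)
Definition supported s P := lspan (fun m => exists2 x, P x & translates s x m).

Definition up_fixed v := forall x : F, gact (up x) v = v.

(** The intrinsic form of the objects of the category: the span of s generates the
    module over kU, freely modulo the U-fixed vectors of this span.  Freeness is stated at
    position 0 only, as translation by U gives it elsewhere ([family_coeff]). *)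
Record free_family s : Prop := FreeFamily {
  family_eigen : forall v, v \in s -> is_eigenvector v;
  family_gen : forall m, supported s (fun=> True) m;
  family_free : forall v, span s v -> supported s (fun x => x <> 0) v -> up_fixed v }.

Lemma translates_subspace s x : subspace (translates s x).
Proof.
split=> [|a _ _ [v Vv ->] [w Vw ->]].
  by exists 0; [apply: lspan0 | rewrite linear0].
exists (a *: v + w); last by rewrite linearP.
by apply: subspaceP => //; apply: lspan_subspace.
Qed.

Lemma supported_subspace s P : subspace (supported s P).
Proof. exact: lspan_subspace. Qed.

Lemma supported_mono s P Q m : (forall x, P x -> Q x) -> supported s P m -> supported s Q m.
Proof. by move=> PQ; apply: lspan_mono => y [x Px]; exists x => //; apply: PQ. Qed.

Lemma supported_gen s P x v : P x -> span s v -> supported s P (gact (up x) v).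
Proof. by move=> Px Vv; apply: lspan_incl; exists x => //; exists v. Qed.

Lemma supported_span s P v : P 0 -> span s v -> supported s P v.
Proof. by move=> P0 Vv; rewrite -[v]gact1 -up0; apply: supported_gen. Qed.

Lemma supported_image s P (g : SL2 F) (L : M -> Prop) m : subspace L ->
    (forall x v, P x -> span s v -> L (gact g (gact (up x) v))) ->
  supported s P m -> L (gact g m).
Proof.
move=> sL HL; apply: lspan_image => //; first exact: gact_linear.
by move=> _ [x Px [v Vv ->]]; apply: HL.
Qed.

Lemma supported_up s P Q a m : (forall x, P x -> Q (a + x)) ->
  supported s P m -> supported s Q (gact (up a) m).
Proof.
move=> PQ; apply: supported_image; first exact: supported_subspace.
by move=> x v Px Vv; rewrite -gactM upD; apply: supported_gen => //; apply: PQ.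
Qed.

Lemma supported_normal s P m : supported s P m -> exists S (phi : F -> M),
  [/\ uniq S, forall x, x \in S -> P x, forall x, span s (phi x)
    & m = \sum_(x <- S) gact (up x) (phi x)].
Proof.
move=> /(lspan_normal (translates_subspace s))[S [phi [uS PS tphi ->]]].
have /choice[psi Hpsi] : forall x, exists v, span s v /\ phi x = gact (up x) v.
  by move=> x; have [v Vv e] := tphi x; exists v.
exists S, psi; split=> // [x|]; first by case: (Hpsi x).
by apply: eq_bigr => x _; case: (Hpsi x).
Qed.

Section Torus.
Variable s : seq M.
Hypothesis eig : forall v, v \in s -> is_eigenvector v.

Lemma span_eigen v : span s v -> lspan (@is_eigenvector F k M) v.
Proof. exact: lspan_mono. Qed.

Lemma span_dg t v : span s v -> span s (gact (dg t) v).
Proof.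
apply: lspan_image; [exact: gact_linear | exact: lspan_subspace |].
move=> x xs; have [a ->] := eigenvector_dg t (eig xs).
by apply: subspaceZ; [exact: lspan_subspace | apply: lspan_incl].
Qed.

Lemma supported_dg P Q t m : t != 0 -> (forall x, P x -> Q (t ^+ 2 * x)) ->
  supported s P m -> supported s Q (gact (dg t) m).
Proof.
move=> t0 PQ; apply: supported_image; first exact: supported_subspace.
move=> x v Px Vv; rewrite -gactM dg_up // gactM; apply: supported_gen.
  exact: PQ.
exact: span_dg.
Qed.

End Torus.

Section FreeFamily.
Variable s : seq M.
Hypothesis gs : free_family s.

Let eig := family_eigen gs.

Lemma up_fixed_subspace : subspace up_fixed.
Proof.
split=> [x|a v w fv fw x]; first by rewrite linear0.
by rewrite linearP /= fv fw.
Qed.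

Lemma family_coeff (S : seq F) (phi : F -> M) x0 : uniq S -> (forall x, span s (phi x)) ->
    x0 \in S -> supported s (fun x => x <> x0) (\sum_(x <- S) gact (up x) (phi x)) ->
  up_fixed (phi x0).
Proof.
move=> uS Vphi x0S; rewrite (bigD1_seq x0) //= => H.
apply: (family_free gs); first exact: Vphi.
rewrite -[phi x0]gact1 -up0 -(addNr x0) -upD gactM.
apply: (supported_up (P := fun x => x <> x0)).
  by move=> x xx0 /addrI.
rewrite -[gact (up x0) (phi x0)](addrK (\sum_(i <- S | i != x0) gact (up i) (phi i))).
apply: (subspaceB (supported_subspace _ _) H); rewrite -big_filter.
apply: (subspace_sum (supported_subspace _ _)) => x; rewrite mem_filter => /andP[xx0 _].
by apply: supported_gen => //; apply/eqP.
Qed.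

Lemma family_coeff0 (S : seq F) (phi : F -> M) : uniq S -> (forall x, span s (phi x)) ->
  \sum_(x <- S) gact (up x) (phi x) = 0 -> forall x, x \in S -> up_fixed (phi x).
Proof.
move=> uS Vphi e x xS; apply: family_coeff uS Vphi xS _.
by rewrite e; apply: lspan0.
Qed.

(** An eigenvector has a support stable under scaling by squares, up to U-fixed
    terms; being finite, this support is contained in {0}. *)
Lemma eigenvector_span v : is_eigenvector v -> span s v.
Proof.
move=> ev; have [->|v0] := eqVneq v 0; first exact: lspan0.
have [lam wv] := (eigenvectorP v).1 ev.
have [S [phi [uS _ Vphi def_v]]] := supported_normal (family_gen gs v).
rewrite def_v; apply: (subspace_sum (lspan_subspace _)) => x0 x0S.
have [->|x00] := eqVneq x0 0; first by rewrite up0 gact1.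
suff -> : gact (up x0) (phi x0) = phi x0 by [].
apply: (family_coeff uS Vphi x0S); rewrite -def_v.
have pE (x y : F) : (x *: 'X^2 - x0%:P).[y] = x * y ^+ 2 - x0.
  by rewrite hornerD hornerN hornerZ hornerXn hornerC.
pose ps := 'X :: [seq x *: 'X^2 - x0%:P | x <- S].
have [|t Ht] := @closed_field_avoid F ps.
  move=> p; rewrite inE => /predU1P[->|/mapP[x _ ->]]; first by rewrite polyX_eq0.
  apply/eqP => /(congr1 (fun p => p.[0])) /eqP.
  by rewrite pE expr0n horner0 /= mulr0 sub0r oppr_eq0 (negbTE x00).
have t0 : t != 0 by have := Ht 'X (mem_head _ _); rewrite hornerX.
have l0 := has_weight_neq0 t v0 wv.
apply: (subspaceZI (supported_subspace _ _) l0); rewrite -wv def_v.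
rewrite linear_sum; apply: (subspace_sum (supported_subspace _ _)) => x xS.
apply: (supported_dg eig (P := fun y => y = x)) => //.
  move=> _ -> e; have : x *: 'X^2 - x0%:P \in ps.
    by rewrite inE; apply/orP; right; apply/mapP; exists x.
  by move/Ht; rewrite pE mulrC e subrr eqxx.
exact: supported_gen.
Qed.

Lemma span_weyl v : span s v -> span s (gact (weyl F) v).
Proof.
apply: lspan_image; [exact: gact_linear | exact: lspan_subspace |].
by move=> x /eig ex; apply: eigenvector_span; apply: eigenvector_weyl.
Qed.

Lemma lo_finite_support :
  exists S0 : seq F, forall v, span s v -> supported s (fun x => x \in S0) (gact (lo 1) v).
Proof.
suff /(_ s)[S0 HS] : forall r : seq M, exists S0 : seq F, forall v, v \in r ->
    supported s (fun x => x \in S0) (gact (lo 1) v).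
  exists S0 => v; apply: lspan_image => //; first exact: gact_linear.
  exact: supported_subspace.
elim=> [|v r [S1 HS1]]; first by exists [::].
have [S [phi [_ _ Vphi e]]] := supported_normal (family_gen gs (gact (lo 1) v)).
exists (S ++ S1) => w; rewrite inE => /predU1P[->|/HS1]; last first.
  by apply: supported_mono => x xS; rewrite mem_cat xS orbT.
rewrite e; apply: (subspace_sum (supported_subspace _ _)) => x xS.
by apply: supported_gen => //; rewrite mem_cat xS.
Qed.

Lemma dg_sqrt y : y != 0 -> exists t : F,
  [/\ t != 0, t ^+ 2 = y^-1 & (lo y * dg t = dg t * lo 1)%g].
Proof.
move=> y0; have [t t0 t2] := closed_field_sqrt (invr_neq0 y0).
by exists t; split=> //; rewrite dg_lo // t2 invrK mul1r.
Qed.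

Lemma lo_support P : (forall v, span s v -> supported s P (gact (lo 1) v)) ->
  forall y v, y != 0 -> span s v -> supported s (fun x => P (x * y)) (gact (lo y) v).
Proof.
move=> HP y v y0 Vv; have [t [t0 t2 et]] := dg_sqrt y0.
rewrite -[v](dg_actK v t0) -gactM et.
rewrite gactM; apply: (supported_dg eig (P := P)) => //.
  by move=> x Px; rewrite t2 mulrAC mulVf // mul1r.
by apply: HP; apply: span_dg.
Qed.

(** The right factors of [lo_up] move a point w of the support P of [lo 1] on the span
    to the position displayed in the last hypothesis. *)
Lemma lo_up_support P : (forall v, span s v -> supported s P (gact (lo 1) v)) ->
  forall a x v Q, span s v -> a != 0 -> 1 + a * x != 0 ->
    (forall w, P w -> Q (x / (1 + a * x) + w / (a * (1 + a * x)))) ->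
    supported s Q (gact (lo a) (gact (up x) v)).
Proof.
move=> HP a x v Q Vv a0 n0 PQ; rewrite -gactM lo_up // !gactM.
pose b := a / (1 + a * x); have b0 : b != 0 by rewrite mulf_neq0 ?invr_neq0.
apply: (supported_up (P := fun z => Q (x / (1 + a * x) + z))) => //.
apply: (supported_dg eig (P := fun z => P (z * b))); rewrite ?invr_neq0 //.
  move=> z /PQ; rewrite /b; congr (Q (_ + _)); field.
  by rewrite a0 n0.
exact: lo_support.
Qed.

(** For generic y compare [lo 1 (lo y v)] and [lo (1 + y) v].  If S0 supports [lo 1]
    on the span, the former is supported on the points (z + w' y) / (y + z) for
    z, w' in S0, and the latter on the points w / (1 + y).  As functions of y these
    never agree unless w is 0 or 1, so the coefficients of [lo 1 v] at the other w
    are U-fixed. *)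
Lemma lo1_support v : span s v -> supported s (fun x => x = 0 \/ x = 1) (gact (lo 1) v).
Proof.
have [S0 HS0] := lo_finite_support.
apply: lspan_image; [exact: gact_linear | exact: supported_subspace |] => {}v vs.
have Vv : span s v by apply: lspan_incl.
have [S [phi [uS _ Vphi e]]] := supported_normal (family_gen gs (gact (lo 1) v)).
rewrite e; apply: (subspace_sum (supported_subspace _ _)) => w wS.
have [w0|w0] := eqVneq w 0; first by apply: supported_gen => //; left.
have [w1|w1] := eqVneq w 1; first by apply: supported_gen => //; right.
suff -> : gact (up w) (phi w) = phi w by apply: supported_span => //; left.
apply: (family_coeff uS Vphi wS); rewrite -e.
(* The roots of f z w' are the y at which w / (1 + y) = (z + w' y) / (y + z). *)
pose f z w' : {poly F} := w *: ('X + z%:P) - (z%:P + w' *: 'X) * (1 + 'X).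
pose ps := 'X :: (1 + 'X) :: [seq 'X + z%:P | z <- S0] ++ [seq f z w' | z <- S0, w' <- S0].
have [|y Hy] := @closed_field_avoid F ps.
  have XD0 (z : F) : 'X + z%:P != 0.
    by rewrite -[z]opprK polyCN polyXsubC_eq0.
  move=> p; rewrite 2!inE mem_cat => /predU1P[->|/predU1P[->|/orP[/mapP[z _ ->]|]]].
  - by rewrite polyX_eq0.
  - by rewrite addrC XD0.
  - exact: XD0.
  case/allpairsP => -[z w'] /= [_ _ ->]; apply/eqP => f0.
  have f_eq y : w * (y + z) - (z + w' * y) * (1 + y) = 0.
    by have := congr1 (fun p => p.[y]) f0; rewrite !hornerE.
  have z0 : z = 0.
    have w1' : w - 1 != 0 by rewrite subr_eq0.
    by apply: (mulfI w1'); rewrite mulr0 -[RHS](f_eq 0); ring.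
  by case/eqP: w0; apply: oppr_inj; rewrite oppr0 -[RHS](f_eq (-1)) z0; ring.
have y0 : y != 0 by have := Hy 'X (mem_head _ _); rewrite hornerX.
have y1 : 1 + y != 0.
  by have := Hy (1 + 'X) _; rewrite !hornerE; apply; rewrite 2!inE eqxx orbT.
have yz z : z \in S0 -> y + z != 0.
  move=> zS; have := Hy ('X + z%:P) _; rewrite !hornerE; apply.
  by rewrite 2!inE mem_cat; apply/or4P; constructor 3; apply/mapP; exists z.
have fne z w' : z \in S0 -> w' \in S0 -> w * (y + z) - (z + w' * y) * (1 + y) != 0.
  move=> zS wS'; have := Hy (f z w') _; rewrite !hornerE; apply.
  by rewrite 2!inE mem_cat; apply/or4P; constructor 4; apply/allpairsP; exists (z, w').
have [t [t0 t2 et]] := dg_sqrt y1.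
have [a ea] := eigenvector_dg t (eig vs).
rewrite -[gact (lo 1) v](dg_actK _ (t := t^-1)) ?invr_neq0 // invrK.
rewrite -[gact (dg t) (gact _ _)]gactM -et gactM ea.
apply: (supported_dg eig (P := fun x => x <> w / (1 + y))); rewrite ?invr_neq0 //.
  move=> x xw ex; apply: xw; rewrite -ex exprVn t2 invrK; field.
  exact: y1.
rewrite linearZ; apply: (subspaceZ _ (supported_subspace _ _)) => /=.
rewrite -loD gactM.
have := lo_support HS0 y0 Vv; apply: supported_image; first exact: supported_subspace.
move=> x v' xS0 Vv'.
have x1 : 1 + x != 0.
  by have := yz _ xS0; apply: contraNneq => x1; rewrite -[y in y + _]mul1r -mulrDl x1 mul0r.
apply: (lo_up_support HS0); rewrite ?mul1r ?oner_neq0 //.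
move=> w' w'S ew; have /eqP[] := fne _ _ xS0 w'S.
have -> : w = (x / (1 + x) + w' / (1 + x)) * (1 + y) by rewrite ew; field.
by field.
Qed.

End FreeFamily.
End Supports.

(** * The lower unipotent group acting on eigenvectors *)

Section Key.
Variables (F : closedFieldType) (p : nat) (k : fieldType).
Hypothesis pcF : p \in [pchar F].
Hypothesis alg : forall x : F, exists2 m, (0 < m)%N & x ^+ (p ^ m) = x.
Hypothesis char0 : [pchar k] =i pred0.

(** The dichotomy for the orbit of an eigenvector under either unipotent group g,
    whose relations are scaled by the torus and translated by g itself. *)
Lemma eigen_orbit_dichotomy (M : gmod k (SL2 F)) (g : F -> SL2 F) (L : M -> Prop)
    (xi : M) (l : seq (k * F)) : subspace L ->
    g 0 = 1%g -> (forall x y, g (x + y)%R = g x * g y)%g ->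
    (forall x m, L m -> L (gact (g x) m)) ->
    (forall x : F, x != 0 -> exists2 t, t != 0 &
       forall y, (dg t * g y = g (x * y)%R * dg t)%g) ->
    (forall t m, L m -> L (gact (dg t) m)) ->
    is_eigenvector xi -> (forall i, i \in l -> i.2 != 0) ->
    L (xi - \sum_(i <- l) i.1 *: gact (g i.2) xi) ->
  forall x, L (gact (g x) xi - xi).
Proof.
move=> sL g0 gD gL gT TL ev l0 Ll x.
have [->|xi0] := eqVneq xi 0; first by rewrite linear0 subr0; apply: subspace0.
have [lam wxi] := (eigenvectorP xi).1 ev.
rewrite -[xi in _ - xi]gact1 -g0.
apply: (orbit_dichotomy pcF alg (e := fun x => gact (g x) xi) char0 sL _ l0); last first.
  by rewrite g0 gact1.
move=> r a z a0 /= Lr; have [t t0 et] := gT a a0.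
apply: (subspaceZI sL (has_weight_neq0 t xi0 wxi)).
rewrite scaler_sumr (_ : \sum_(i <- r) _ =
    gact (g z) (gact (dg t) (\sum_(i <- r) i.1 *: gact (g i.2) xi))).
  by apply: gL; apply: TL.
rewrite !linear_sum; apply: eq_bigr => i _ /=; rewrite !linearZ /=.
rewrite -[gact (dg t) _]gactM et gactM wxi !linearZ /= -gactM -gD addrC.
by rewrite scalerA mulrC -scalerA.
Qed.

Section FreeFamilyModule.
Variables (M : gmod k (SL2 F)) (s : seq M).
Hypothesis gs : free_family s.
Let eig := family_eigen gs.

(** The vectors supported on the projective line minus 0: the U-fixed vectors, which
    belong to O, play the part of the fibre at infinity. *)
Let O := supported s (fun x => x <> 0).

(** The opposite Borel subgroup fixes 0 on the projective line, hence preserves its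
    complement. *)
Lemma lo_open_cell z m : O m -> O (gact (lo z) m).
Proof.
have [->|z0] := eqVneq z 0; first by rewrite lo0 gact1.
apply: supported_image; first exact: supported_subspace.
move=> a v a0 Vv; have [n0|n0] := eqVneq (1 + z * a) 0.
  have -> : a = - z^-1.
    by rewrite -[LHS](mulKf z0); move/eqP: n0; rewrite addrC addr_eq0 => /eqP ->; rewrite mulrN1.
  rewrite -gactM lo_up_weyl // !gactM; apply: supported_gen.
    by apply/eqP; rewrite invr_eq0.
  by apply: span_weyl => //; apply: span_dg.
apply: (lo_up_support gs (lo1_support gs)) => // w [] -> e.
  by apply: a0; rewrite mul0r addr0 in e; rewrite -[LHS](divfK n0) e mul0r.
have /eqP[] : z^-1 != 0 by rewrite invr_eq0.
by rewrite -e; field; rewrite z0 n0.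
Qed.

Lemma dg_open_cell t m : O m -> O (gact (dg t) m).
Proof.
have [->|t0] := eqVneq t 0; first by rewrite dg0 gact1.
apply: supported_dg => // x x0 /eqP; rewrite mulf_eq0 expf_eq0 (negbTE t0) /=.
by move/eqP.
Qed.

Lemma span_mod_open_cell m : exists2 v, span s v & O (m - v).
Proof.
have [S [phi [uS _ Vphi ->]]] := supported_normal (family_gen gs m).
exists (\sum_(x <- S | x == 0) phi x).
  by rewrite -big_filter; apply: (subspace_sum (lspan_subspace _)).
have e : \sum_(x <- S | x == 0) gact (up x) (phi x) = \sum_(x <- S | x == 0) phi x.
  by apply: eq_bigr => x /eqP ->; rewrite up0 gact1.
rewrite (bigID (fun x => x == 0)) /= e.
rewrite [X in X - _]addrC addrK -big_filter.
apply: (subspace_sum (supported_subspace _ _)) => x; rewrite mem_filter => /andP[x0 _].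
by apply: supported_gen => //; apply/eqP.
Qed.

(** The quotient by O is finite dimensional, being spanned by the eigenvectors, and F
    is infinite; so the orbit of an eigenvector under the lower unipotent group
    satisfies a nontrivial relation modulo O, and the dichotomy applies. *)
Lemma lo_trivial_mod_open_cell v x : span s v -> O (gact (lo x) v - v).
Proof.
move=> Vv; have sO : subspace O := supported_subspace _ _.
pose f (v : M) := gact (lo x) v - v.
apply: (lspan_image (f := f) _ sO _ Vv) => [a y z|xi /eig exi].
  by rewrite /f linearP scalerBr opprD addrACA.
have [R [uR sR _]] := frobenius_fixed_enum pcF (ltn0Sn (size s)).
have lt_sR : (size s < size R)%N.
  by rewrite sR ltnW // ltn_expl // prime_gt1 // (pcharf_prime pcF).
have [c [[i0 ci0] Lc]] := dependent_mod (y := fun i : 'I_(size R) => gact (lo R`_i) xi)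
  sO lt_sR (fun i => span_mod_open_cell _).
(* Translating by - R`_i0 and dividing by c i0 isolates the value at 0. *)
pose l := [seq (- (c i0)^-1 * c i, R`_i - R`_i0) | i : 'I_(size R) <- enum (predC1 i0)].
apply: (eigen_orbit_dichotomy (l := l)) => //.
- exact: lo0.
- by move=> y z; rewrite loD.
- exact: lo_open_cell.
- move=> y y0; have [t t0 t2] := closed_field_sqrt (invr_neq0 y0).
  by exists t => // z; rewrite dg_lo // t2 invrK mulrC.
- exact: dg_open_cell.
- move=> cx /mapP[i]; rewrite mem_enum => i_ne -> /=.
  by rewrite subr_eq0 nth_uniq.
have := subspaceZ (c i0)^-1 sO (lo_open_cell (- R`_i0) Lc).
congr O; rewrite linear_sum (bigD1 i0) //= linearZ scalerDr scalerA mulVf //= scale1r.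
rewrite -gactM loD addNr lo0 gact1 big_map big_enum -sumrN scaler_sumr /=; congr (_ + _).
apply: eq_bigr => i _; rewrite linearZ /= -gactM loD [- _ + _]addrC scalerA.
by rewrite mulNr scaleNr opprK.
Qed.

(** The defect of the formula [lo 1 v = v + up 1 (weyl v)], which holds modulo U-fixed
    vectors; for a U-fixed v it is - v. *)
Definition omega (v : M) := gact (lo 1) v - gact (up 1) (gact (weyl F) v) - v.

(** With nv = weyl v, write [lo 1 nv = a + up 1 c]; triviality modulo O makes [a - nv]
    U-fixed.  Applying [up (-1)] and then the inverse of weyl, which conjugates
    [up (-1)] to [lo 1], yields [lo 1 v - up 1 nv] in V.  So omega v is in V, and it
    lies in O by triviality again. *)
Theorem omega_up_fixed v : span s v -> span s (omega v) /\ up_fixed (omega v).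
Proof.
move=> Vv; have sV : subspace (span s) := lspan_subspace _.
have sO : subspace O := supported_subspace _ _.
have O1 w : span s w -> O (gact (up 1) w).
  by move=> Vw; apply: supported_gen => //; apply/eqP; apply: oner_neq0.
have Vnv := span_weyl gs Vv; set nv := gact (weyl F) v in Vnv *.
have [a [c [Va Vc e]]] : exists a c, [/\ span s a, span s c &
    gact (lo 1) nv = a + gact (up 1) c].
  pose L m := exists a c, [/\ span s a, span s c & m = a + gact (up 1) c].
  apply: (@lspan_min _ _ _ L _ _ _ (lo1_support gs Vnv)).
    split=> [|b _ _ [a [c [Va Vc ->]]] [a' [c' [Va' Vc' ->]]]].
      by exists 0, 0; split; rewrite ?linear0 ?addr0; do ?apply: lspan0.
    exists (b *: a + a'), (b *: c + c'); split; do ?exact: subspaceP.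
    by rewrite linearP /= scalerDr addrACA.
  move=> _ [x x01 [w Vw ->]]; case: x01 => ->.
    by exists w, 0; split; [|apply: lspan0|]; rewrite // up0 gact1 linear0 addr0.
  by exists 0, w; split; [apply: lspan0 | | ]; rewrite ?add0r.
have fix_a : up_fixed (a - nv).
  apply: (family_free gs); first exact: subspaceB.
  have -> : a - nv = (gact (lo 1) nv - nv) - gact (up 1) c.
    by rewrite e addrAC addrK.
  by apply: subspaceB => //; [apply: lo_trivial_mod_open_cell | apply: O1].
have Vom : span s (omega v).
  pose d := gact (up 1) nv - gact (lo 1) v.
  have nd : gact (weyl F) d = a - nv + c.
    rewrite linearB /= -[gact _ (gact (lo 1) v)]gactM weyl_lo gactM -/nv.
    have -> : gact (weyl F) (gact (up 1) nv) = gact (up (-1)) (gact (lo 1) nv).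
      by rewrite lo1 -!gactM !mulgA upD addNr up0 mul1g.
    rewrite e linearD /= -[gact _ (gact (up 1) c)]gactM upD addNr up0 gact1 addrAC.
    by rewrite -linearB /= fix_a.
  have Vd : span s d.
    rewrite -[d]gact1 -weyl4 !gactM nd.
    by do ?apply: span_weyl => //; apply: subspaceD => //; apply: subspaceB.
  have -> : omega v = - d - v by rewrite /d opprB.
  by apply: subspaceB => //; apply: subspaceN.
split=> //; apply: (family_free gs) => //.
rewrite /omega addrAC; apply: subspaceB => //; last exact: O1.
exact: lo_trivial_mod_open_cell.
Qed.

End FreeFamilyModule.
End Key.

(** * Free families and membership in the category *)

Section UnipotentSpan.
Variables (F : closedFieldType) (k : fieldType) (M : gmod k (SL2 F)).
Implicit Types (xi m : M).

Lemma unipotent_spanE xi m :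
  unipotent_span xi m <-> lspan (fun y => exists2 x, True & y = gact (up x) xi) m.
Proof.
split=> [[n [c [u [uU ->]]]]|].
  apply: (subspace_sum (lspan_subspace _)) => i _.
  apply: (subspaceZ _ (lspan_subspace _)); apply: lspan_incl.
  by have [x ->] := unipotentE _ (uU i); exists x.
elim=> {m} [|a _ m [x _ ->] _ [n [c [u [uU ->]]]]].
  exists 0, (fun=> 0), (fun=> 1%g); split; last by rewrite big_ord0.
  by case.
exists n.+1, (fun i => if unlift ord0 i is Some j then c j else a),
  (fun i => if unlift ord0 i is Some j then u j else up x); split.
  by move=> i; case: unliftP => [j|] _ //; apply/unipotentE; exists x.
rewrite big_ord_recl unlift_none; congr (_ + _).
by apply: eq_bigr => i _; rewrite liftK.
Qed.

Lemma orbit_list (P : F -> Prop) xi m :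
    lspan (fun y => exists2 x, P x & y = gact (up x) xi) m ->
  exists2 l : seq (k * F), forall i, i \in l -> P i.2 &
    m = \sum_(i <- l) i.1 *: gact (up i.2) xi.
Proof.
elim=> {m} [|a _ m [x Px ->] _ [l lP ->]]; first by exists [::]; rewrite ?big_nil.
exists ((a, x) :: l); last by rewrite big_cons.
by move=> i; rewrite inE => /predU1P[->|/lP].
Qed.

(** A common list of translations lets sums over several orbits be regrouped by
    translation, as freeness requires. *)
Lemma orbit_common_list n (xi y : 'I_n -> M) :
    (forall i, lspan (fun z => exists2 x, True & z = gact (up x) (xi i)) (y i)) ->
  exists (S : seq F) (c : 'I_n -> F -> k), uniq S /\
    forall i, y i = \sum_(x <- S) c i x *: gact (up x) (xi i).
Proof.
move=> H; have /choice[l Hl] : forall i, exists l : seq (k * F),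
    y i = \sum_(q <- l) q.1 *: gact (up q.2) (xi i).
  by move=> i; have [l _ ->] := orbit_list (H i); exists l.
exists (undup (flatten [seq map snd (l i) | i <- enum 'I_n])).
exists (fun i x => \sum_(q <- l i | q.2 == x) q.1); split; first exact: undup_uniq.
move=> i; rewrite Hl; under [RHS]eq_bigr => x _ do rewrite scaler_suml.
rewrite (exchange_big_dep xpredT) //=; apply: eq_big_seq => q ql.
rewrite (eq_bigl (pred1 q.2)) => [|x]; last by rewrite /= eq_sym.
rewrite -big_filter filter_pred1_uniq ?undup_uniq ?big_seq1 //.
rewrite mem_undup; apply/flattenP; exists (map snd (l i)); last exact: map_f.
by apply: map_f; rewrite mem_enum.
Qed.

End UnipotentSpan.

Section FreeFamilyCatC.
Variables (F : closedFieldType) (p : nat) (k : fieldType).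
Hypothesis pcF : p \in [pchar F].
Hypothesis alg : forall x : F, exists2 m, (0 < m)%N & x ^+ (p ^ m) = x.
Hypothesis char0 : [pchar k] =i pred0.
Variable M : gmod k (SL2 F).
Implicit Types (v m xi : M) (s : seq M).

Lemma up_borel (x : F) : up x \in borel F.
Proof. by apply/borelE; exists 1; rewrite ?oner_neq0 //; exists x; rewrite dg1 mulg1. Qed.

Lemma dg_borel (t : F) : t != 0 -> dg t \in borel F.
Proof. by move=> t0; apply/borelE; exists t => //; exists 0; rewrite up0 mul1g. Qed.

(** The vectors corresponding to the xi i in the direct sum decomposition form the
    family.  Freeness is checked one summand at a time: if a multiple of xi i is a
    combination of proper translates of xi i, the dichotomy makes xi i U-fixed. *)
Lemma in_catC_free_family : in_catC M -> exists s, free_family s.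
Proof.
move=> [n [_ [xi [exi [phi [lphi iphi imphi Bphi]]]]]].
pose E i z : {ffun 'I_n -> M} := [ffun j => if j == i then z else 0].
have phi0 : phi 0 = 0 by rewrite -[0 in LHS](subrr 0) -scaleN1r addrC lphi scaleN1r addNr.
have orb i x : lspan (fun z => exists2 x, True & z = gact (up x) (xi i)) (gact (up x) (xi i)).
  by apply: lspan_incl; exists x.
have /choice[eta Heta] : forall i, exists m, phi m = E i (xi i).
  move=> i; apply/imphi => j; rewrite ffunE; apply/unipotent_spanE.
  case: eqP => [->|_]; last exact: lspan0.
  by rewrite -[X in lspan _ X]gact1 -up0.
have phi_eta i x : phi (gact (up x) (eta i)) = E i (gact (up x) (xi i)).
  apply/ffunP => j; rewrite Bphi ?up_borel // Heta !ffunE.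
  by case: ifP => _ //; rewrite linear0.
pose s := [seq eta i | i <- enum 'I_n].
have mem_eta i : eta i \in s by apply: map_f; rewrite mem_enum.
have comp_lin j : linear (fun m => phi m j) by move=> a x y; rewrite lphi !ffunE.
have comp_eta i j : phi (eta i) j = if j == i then xi i else 0 by rewrite Heta ffunE.
have span_comp v j : span s v -> exists c, phi v j = c *: xi j.
  apply: (@lspan_image k M M (fun m => phi m j) _ (fun z => exists c, z = c *: xi j)) => //.
    split=> [|a _ _ [c ->] [c' ->]]; first by exists 0; rewrite scale0r.
    by exists (a * c + c'); rewrite scalerDl scalerA.
  move=> _ /mapP[i _ ->]; rewrite comp_eta; case: eqP => [->|_].
    by exists 1; rewrite scale1r.
  by exists 0; rewrite scale0r.
exists s; split.
- move=> _ /mapP[i _ ->]; apply/eigenvectorP.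
  have [lam wxi] := (eigenvectorP _).1 (exi i); exists lam => t.
  have [->|t0] := eqVneq t 0.
    apply: iphi; rewrite -[lam 0 *: _]addr0 lphi phi0 addr0 Heta; apply/ffunP => j.
    rewrite dg0 gact1 Heta !ffunE; case: ifP => _; last by rewrite scaler0.
    by rewrite -wxi dg0 gact1.
  apply: iphi; rewrite -[lam t *: _]addr0 lphi phi0 addr0; apply/ffunP => j.
  rewrite Bphi ?dg_borel // Heta !ffunE; case: ifP => _; last by rewrite linear0 scaler0.
  exact: wxi.
- move=> m; have sup i z : lspan (fun z => exists2 x, True & z = gact (up x) (xi i)) z ->
      exists2 m', supported s (fun=> True) m' & phi m' = E i z.
    move: z; apply: lspan_min.
      split=> [|a z z' [m1 sm1 e1] [m2 sm2 e2]].
        exists 0; first exact: lspan0.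
        by rewrite phi0; apply/ffunP => j; rewrite !ffunE if_same.
      exists (a *: m1 + m2); first by apply: subspaceP => //; apply: supported_subspace.
      rewrite lphi e1 e2; apply/ffunP => j; rewrite !ffunE.
      by case: ifP => _ //; rewrite scaler0 addr0.
    move=> _ [x _ ->]; exists (gact (up x) (eta i)); last exact: phi_eta.
    by apply: supported_gen => //; apply: lspan_incl.
  have /choice[mi Hmi] : forall i, exists m', supported s (fun=> True) m' /\ phi m' = E i (phi m i).
    move=> i; have [|m' sm' e] := sup i (phi m i); last by exists m'.
    by apply/unipotent_spanE; apply: (imphi (phi m)).1; exists m.
  suff -> : m = \sum_i mi i.
    by apply: (subspace_sum (supported_subspace _ _)) => i _; case: (Hmi i).
  apply: iphi; apply/ffunP => j.
  pose f : {linear M -> M} :=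
    HB.pack (fun m => phi m j) (GRing.isLinear.Build _ _ _ _ _ (comp_lin j)).
  rewrite -[RHS]/(f (\sum_i mi i)) linear_sum (bigD1 j) //= big1 ?addr0 => [|i ij].
    by have [_ ->] := Hmi j; rewrite ffunE eqxx.
  by have [_ ->] := Hmi i; rewrite ffunE eq_sym (negbTE ij).
move=> v Vv Ov x; apply: iphi; apply/ffunP => j; rewrite Bphi ?up_borel //.
have [c ec] := span_comp v j Vv; rewrite ec linearZ /=.
have [->|c0] := eqVneq c 0; first by rewrite !scale0r.
have Oj : lspan (fun y => exists2 x, x <> 0 & y = gact (up x) (xi j)) (c *: xi j).
  rewrite -ec; apply: (@lspan_image k M M (fun m => phi m j)) Ov => //.
    exact: lspan_subspace.
  move=> _ [y y0 [w Vw ->]]; rewrite Bphi ?up_borel //.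
  have [d ->] := span_comp w j Vw; rewrite linearZ /=.
  by apply: (subspaceZ _ (lspan_subspace _)); apply: lspan_incl; exists y.
have [l l0 el] := orbit_list (subspaceZI (lspan_subspace _) c0 Oj).
congr (c *: _); apply/eqP; rewrite -subr_eq0; apply/eqP.
apply: (eigen_orbit_dichotomy pcF alg char0 (g := @up F) (L := fun m => m = 0) (l := l)) => //.
- exact: subspace_zero.
- exact: up0.
- by move=> y z; rewrite upD.
- by move=> y _ ->; rewrite linear0.
- move=> y /closed_field_sqrt[t t0 t2]; exists t => // z.
  by rewrite dg_up // t2.
- by move=> t _ ->; rewrite linear0.
- by move=> i /l0 /eqP.
by rewrite -el subrr.
Qed.

Lemma supported_span_mono s s' P m : (forall v, span s v -> span s' v) ->
  supported s P m -> supported s' P m.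
Proof.
by move=> ss'; apply: lspan_mono => _ [x Px [v Vv ->]]; exists x => //; exists v => //; apply: ss'.
Qed.

(** A basis of eigenvectors adapted to the U-fixed subspace.  The latter is stable
    under the torus, hence spanned by its eigenvectors. *)
Lemma free_family_adapted s : free_family s -> exists s1 s2,
  [/\ free_family (s1 ++ s2), indep (s1 ++ s2), forall v, v \in s1 -> up_fixed v
    & forall v, span (s1 ++ s2) v -> up_fixed v -> span s1 v].
Proof.
move=> gs; pose E1 v := is_eigenvector v /\ (up_fixed v /\ span s v).
have [||i|s1 [E1s1 ind1 span1]] := @indep_extend _ _ E1 s [::].
- by move=> v [_ []].
- by [].
- by rewrite big_ord0.
rewrite /= in ind1 span1.
have [||//|s2 [ss2 ind2 span2]] := @indep_extend _ _ (fun v => v \in s) s s1.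
- by move=> v vs; apply: lspan_incl.
- by move=> v /E1s1[_ []].
have s_to v : span s v -> span (s1 ++ s2) v.
  by apply: lspan_min => //; apply: lspan_subspace.
have to_s v : span (s1 ++ s2) v -> span s v.
  apply: lspan_min; first exact: lspan_subspace.
  by move=> x; rewrite mem_cat => /orP[/E1s1[_ []]//|/ss2]; apply: lspan_incl.
exists s1, s2; split=> //.
- split.
  + by move=> v; rewrite mem_cat => /orP[/E1s1[]//|/ss2 /(family_eigen gs)].
  + by move=> m; apply: supported_span_mono s_to (family_gen gs m).
  + move=> v /to_s Vv; move/(supported_span_mono to_s); exact: family_free.
- by move=> v /E1s1[_ []].
move=> v /to_s Vv fv; apply: (lspan_min (lspan_subspace _) span1).
apply: weight_components => //.
- by split=> [|a x y [fx sx] [fy sy]]; [split; [apply: (subspace0 (@up_fixed_subspace _ _ _))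
    | apply: lspan0] | split; [apply: (subspaceP (@up_fixed_subspace _ _ _))
    | apply: (subspaceP (lspan_subspace _))]].
- move=> t m [fm sm]; split; last exact: (span_dg (family_eigen gs)).
  have [->|t0] := eqVneq t 0; first by rewrite dg0 gact1.
  move=> x; rewrite -gactM.
  have -> : (up x * dg t = dg t * up (x / t ^+ 2))%g.
    by rewrite dg_up // mulrC divfK // expf_neq0.
  by rewrite gactM fm.
exact: (span_eigen (family_eigen gs)).
Qed.

Lemma span_cat_coef s1 s2 (c : nat -> k) : indep (s1 ++ s2) ->
  span s1 (\sum_(i < size (s1 ++ s2)) c i *: (s1 ++ s2)`_i) ->
  forall i, (size s1 <= i)%N -> (i < size (s1 ++ s2))%N -> c i = 0.
Proof.
move=> ind /lspan_seqP[d e] i le_i lt_i.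
pose d' j := if (j < size s1)%N then d j else 0.
have ed : \sum_(i < size s1) d i *: s1`_i = \sum_(i < size (s1 ++ s2)) d' i *: (s1 ++ s2)`_i.
  rewrite size_cat big_split_ord /= [X in _ + X]big1 ?addr0 => [|j _].
    by apply: eq_bigr => j _; rewrite /d' nth_cat ltn_ord.
  by rewrite /d' ltnNge leq_addr scale0r.
have := ind (fun i => c i - d' i) _ i lt_i; rewrite /d' ltnNge le_i subr0; apply.
under eq_bigr => j _ do rewrite scalerBl.
by rewrite sumrB e ed subrr.
Qed.

(** In an adapted basis, each element of s1 spans a trivial kU-module and each element
    of s2 a free one; so decompositions along the orbits are unique, and the
    resulting map is the required isomorphism.  The eigenvectors lie in the span of
    the basis, so its size is the dimension of their sum. *)
Lemma free_family_in_catC s : free_family s -> in_catC M.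
Proof.
move=> /free_family_adapted[s1 [s2 [gs ind fix1 span1]]].
set b := s1 ++ s2 in gs ind span1; set n := size b.
pose xi (i : 'I_n) := b`_i.
pose orb i := lspan (fun z => exists2 x, True & z = gact (up x) (xi i)).
have exi i : is_eigenvector (xi i) by apply: (family_eigen gs); apply: mem_nth.
have ind' (c : 'I_n -> k) : \sum_i c i *: xi i = 0 -> forall i, c i = 0.
  move=> e i; have := ind (fun j => oapp c 0 (insub j)) _ i (ltn_ord i).
  rewrite valK; apply; rewrite -[RHS]e.
  by apply: eq_bigr => j _; rewrite valK.
exists n; split.
  exists xi; split=> //.
    move=> i; have [lam wi] := exi i; exists 1, (fun=> lam), (fun=> xi i).
    by rewrite big_ord1.
  move=> _ [m [lam [y [wy ->]]]].
  have /lspan_seqP[c ->] : span b (\sum_i y i); last by exists (fun i => c i).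
  apply: (subspace_sum (lspan_subspace _)) => i _.
  by apply: (eigenvector_span gs); exists (lam i).
exists xi; split=> //.
have uniq0 (y : 'I_n -> M) : (forall i, orb i (y i)) -> \sum_i y i = 0 -> forall i, y i = 0.
  move=> /orbit_common_list[S [c [uS ey]]] y0.
  have fix_c x : x \in S -> up_fixed (\sum_i c i x *: xi i).
    apply: (family_coeff0 gs uS (phi := fun x => \sum_i c i x *: xi i)).
      move=> z; apply: (subspace_sum (lspan_subspace _)) => i _.
      by apply: (subspaceZ _ (lspan_subspace _)); apply: lspan_incl; apply: mem_nth.
    rewrite -[RHS]y0; under [RHS]eq_bigr => i _ do rewrite ey.
    rewrite exchange_big; apply: eq_bigr => z _.
    by rewrite linear_sum; apply: eq_bigr => i _; rewrite linearZ.
  have c0 (i : 'I_n) x : x \in S -> (size s1 <= i)%N -> c i x = 0.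
    move=> xS le_i.
    have := @span_cat_coef s1 s2 (fun j => oapp (c^~ x) 0 (insub j)) ind _ i le_i (ltn_ord i).
    rewrite valK; apply; apply: span1.
      by apply: (subspace_sum (lspan_subspace _)) => j _;
        apply: (subspaceZ _ (lspan_subspace _)); apply: lspan_incl; apply: mem_nth.
    have := fix_c x xS; congr up_fixed.
    by apply: eq_bigr => j _; rewrite valK.
  have ey' i : y i = (\sum_(x <- S) c i x) *: xi i.
    rewrite ey scaler_suml; apply: eq_big_seq => x xS.
    have [le_i|lt_i] := leqP (size s1) i; first by rewrite c0 // !scale0r.
    by rewrite fix1 // /xi /b nth_cat lt_i mem_nth.
  have C0 : forall i, \sum_(x <- S) c i x = 0.
    by apply: ind'; rewrite -[RHS]y0; apply: eq_bigr => i _; rewrite ey'.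
  by move=> i; rewrite ey' C0 scale0r.
pose Dec m (y : {ffun 'I_n -> M}) := (forall i, orb i (y i)) /\ m = \sum_i y i.
have DecP a m m' y y' : Dec m y -> Dec m' y' -> Dec (a *: m + m') (a *: y + y').
  move=> [oy ->] [oy' ->]; split.
    by move=> i; rewrite !ffunE; apply: (subspaceP (lspan_subspace _)); [apply: oy | apply: oy'].
  by rewrite scaler_sumr -big_split; apply: eq_bigr => i _; rewrite !ffunE.
have Dec_uniq m y y' : Dec m y -> Dec m y' -> y = y'.
  move=> Dy Dy'; have [oy] := DecP (-1) _ _ _ _ Dy Dy'.
  rewrite scaleN1r addNr => /esym/(uniq0 _ oy) e; apply/ffunP => i.
  by have := e i; rewrite !ffunE scaleN1r addrC => /subr0_eq ->.
have Dec_ex m : exists y, Dec m y.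
  have := family_gen gs m; move: m; apply: lspan_min.
    split=> [|a m m' [y Dy] [y' Dy']]; last by exists (a *: y + y'); apply: DecP.
    exists 0; split; first by move=> i; rewrite ffunE; apply: lspan0.
    by rewrite big1 // => i _; rewrite ffunE.
  move=> _ [x _ [v /lspan_seqP[c ->] ->]].
  exists [ffun i : 'I_n => c i *: gact (up x) (xi i)]; split=> [i|].
    rewrite ffunE; apply: (subspaceZ _ (lspan_subspace _)).
    by apply: lspan_incl; exists x.
  by rewrite linear_sum; apply: eq_bigr => i _; rewrite ffunE linearZ.
have [phi Hphi] := choice Dec_ex; exists phi; split.
- by move=> a x y; apply: Dec_uniq (Hphi _) (DecP _ _ _ _ _ (Hphi _) (Hphi _)).
- by move=> x y e; have [_ ->] := Hphi x; have [_ ->] := Hphi y; rewrite e.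
- move=> y; split=> [[x <-] i|oy].
    apply/unipotent_spanE; case: (Hphi x) => H _; exact: H.
  exists (\sum_i y i); apply: Dec_uniq (Hphi _) _; split=> // i.
  exact/unipotent_spanE.
move=> g /borelE[t t0 [x ->]] m i.
suff D : Dec (gact (up x * dg t)%g m) [ffun i => gact (up x * dg t)%g (phi m i)].
  by rewrite (Dec_uniq _ _ _ (Hphi _) D) ffunE.
have [om em] := Hphi m; split; last first.
  by rewrite {1}em linear_sum; apply: eq_bigr => j _; rewrite ffunE.
move=> j; rewrite ffunE; move: (om j); apply: lspan_image; first exact: gact_linear.
  exact: lspan_subspace.
move=> _ [z _ ->]; rewrite gactM -[gact (dg t) _]gactM dg_up // gactM.
have [a ->] := eigenvector_dg t (exi j); rewrite !linearZ /= -gactM upD.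
by apply: (subspaceZ _ (lspan_subspace _)); apply: lspan_incl; eexists.
Qed.

End FreeFamilyCatC.

(** * Submodules, quotients and products of G-modules *)

Record submodule (k : fieldType) (G : groupType) (M : gmod k G) := Submodule {
  sub_pred :> M -> Prop;
  sub_subspace : subspace sub_pred;
  sub_gact : forall g x, sub_pred x -> sub_pred (gact g x) }.

Section SubGmod.
Variables (k : fieldType) (G : groupType) (M : gmod k G) (I : submodule M).

Definition in_sub : {pred M} := fun x => `[< I x >].

Fact in_sub_closed : submod_closed in_sub.
Proof.
split=> [|a x y]; rewrite !unfold_in.
  by apply/asboolP; apply: subspace0; apply: sub_subspace.
by move=> /asboolP Ix /asboolP Iy; apply/asboolP; apply: subspaceP => //; apply: sub_subspace.
Qed.
HB.instance Definition _ := GRing.isSubmodClosed.Build k M in_sub in_sub_closed.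

Definition sub_carrier := {x : M | x \in in_sub}.
HB.instance Definition _ := SubChoice.on sub_carrier.
HB.instance Definition _ := [SubChoice_isSubLmodule of sub_carrier by <:].

Fact sub_act_subproof g (x : sub_carrier) : gact g (val x) \in in_sub.
Proof. by rewrite unfold_in; apply/asboolP/sub_gact/asboolP/(valP x). Qed.

Definition sub_gmod : gmod k G.
Proof.
apply: (@Gmod k G sub_carrier
  (fun g (x : sub_carrier) => exist _ (gact g (val x)) (sub_act_subproof g x) : sub_carrier)).
- by move=> g a x y; apply: val_inj; rewrite /= !linearP.
- by move=> x; apply: val_inj; rewrite /= gact1.
- by move=> g h x; apply: val_inj; rewrite /= gactM.
Defined.

Definition sub_incl : ghom sub_gmod M.
Proof. by apply: (@Ghom _ _ sub_gmod M (fun x : sub_carrier => val x)). Defined.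

End SubGmod.

Section QuotGmod.
Variables (k : fieldType) (G : groupType) (M : gmod k G) (I : submodule M).

Let sI := sub_subspace I.

(** The quotient is carried by the chosen representatives of the cosets; the choice
    depends on the coset alone, since [choose] depends only on the extension of its
    predicate. *)
Definition quot_repr (x : M) : M := choose (fun y => `[< I (y - x) >]) x.

Lemma quot_repr_mod x : I (quot_repr x - x).
Proof.
apply/asboolP; rewrite /quot_repr; apply: (@chooseP _ (fun y => `[< I (y - x) >])).
by apply/asboolP; rewrite subrr; apply: subspace0.
Qed.

Lemma quot_repr_eq x y : quot_repr x = quot_repr y <-> I (x - y).
Proof.
split=> [e|Ixy].
  have := subspaceB sI (quot_repr_mod y) (quot_repr_mod x).
  by rewrite e opprB addrC addrA subrK.
have same : (fun z => `[< I (z - x) >]) =1 (fun z => `[< I (z - y) >]).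
  move=> z; apply: asbool_equiv_eq; split=> H.
    by rewrite -[z](subrK x) -addrA; apply: subspaceD.
  by rewrite -[z](subrK y) -addrA; apply: subspaceD; rewrite // -opprB; apply: subspaceN.
rewrite /quot_repr (eq_choose same); apply: choose_id; last first.
  by apply/asboolP; rewrite subrr; apply: subspace0.
exact/asboolP.
Qed.

Definition quot_carrier := {x : M | quot_repr x == x}.
HB.instance Definition _ := Choice.on quot_carrier.

Fact quot_mk_subproof x : quot_repr (quot_repr x) == quot_repr x.
Proof. by apply/eqP/quot_repr_eq/quot_repr_mod. Qed.

Definition quot_mk x : quot_carrier :=
  exist _ (quot_repr x) (quot_mk_subproof x).

Lemma quot_mk_eq x y : quot_mk x = quot_mk y <-> I (x - y).
Proof.
rewrite -quot_repr_eq; split=> [/(congr1 val)//|e]; exact: val_inj.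
Qed.

Lemma quot_mkK (a : quot_carrier) : quot_mk (val a) = a.
Proof. by apply: val_inj; apply/eqP/(valP a). Qed.

Lemma quot_mk_val x : I (val (quot_mk x) - x).
Proof. exact: quot_repr_mod. Qed.

Definition quot_add (a b : quot_carrier) := quot_mk (val a + val b).
Definition quot_opp (a : quot_carrier) := quot_mk (- val a).
Definition quot_scale (c : k) (a : quot_carrier) := quot_mk (c *: val a).

Lemma quot_mkD x y : quot_add (quot_mk x) (quot_mk y) = quot_mk (x + y).
Proof.
apply/quot_mk_eq; rewrite opprD addrACA.
by apply: subspaceD => //; apply: quot_mk_val.
Qed.

Lemma quot_mkN x : quot_opp (quot_mk x) = quot_mk (- x).
Proof.
by apply/quot_mk_eq; rewrite -opprD; apply: subspaceN => //; apply: quot_mk_val.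
Qed.

Lemma quot_mkZ c x : quot_scale c (quot_mk x) = quot_mk (c *: x).
Proof.
by apply/quot_mk_eq; rewrite -scalerBr; apply: subspaceZ => //; apply: quot_mk_val.
Qed.

Lemma quot_mk_surj a : exists x, a = quot_mk x.
Proof. by exists (val a); rewrite quot_mkK. Qed.

Fact quot_addA : associative quot_add.
Proof.
move=> a b c; have [x ->] := quot_mk_surj a; have [y ->] := quot_mk_surj b.
by have [z ->] := quot_mk_surj c; rewrite !quot_mkD addrA.
Qed.
Fact quot_addC : commutative quot_add.
Proof. by move=> a b; rewrite /quot_add addrC. Qed.
Fact quot_add0 : left_id (quot_mk 0) quot_add.
Proof. by move=> a; have [x ->] := quot_mk_surj a; rewrite quot_mkD add0r. Qed.
Fact quot_addN : left_inverse (quot_mk 0) quot_opp quot_add.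
Proof. by move=> a; have [x ->] := quot_mk_surj a; rewrite quot_mkN quot_mkD addNr. Qed.
HB.instance Definition _ := GRing.isZmodule.Build quot_carrier
  quot_addA quot_addC quot_add0 quot_addN.

Fact quot_scaleA c d a : quot_scale c (quot_scale d a) = quot_scale (c * d) a.
Proof. by have [x ->] := quot_mk_surj a; rewrite !quot_mkZ scalerA. Qed.
Fact quot_scale1 : left_id 1 quot_scale.
Proof. by move=> a; have [x ->] := quot_mk_surj a; rewrite quot_mkZ scale1r. Qed.
Fact quot_scaleDr : right_distributive quot_scale +%R.
Proof.
move=> c a b; have [x ->] := quot_mk_surj a; have [y ->] := quot_mk_surj b.
by rewrite /GRing.add /= !(quot_mkD, quot_mkZ) scalerDr.
Qed.
Fact quot_scaleDl a : {morph quot_scale^~ a : c d / c + d}.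
Proof.
move=> c d; have [x ->] := quot_mk_surj a.
by rewrite /GRing.add /= !quot_mkZ quot_mkD -scalerDl.
Qed.
HB.instance Definition _ := GRing.Zmodule_isLmodule.Build k quot_carrier
  quot_scaleA quot_scale1 quot_scaleDr quot_scaleDl.

Lemma quot_mk_linear : linear quot_mk.
Proof. by move=> c x y; rewrite -quot_mkD -quot_mkZ. Qed.

Definition quot_act g (a : quot_carrier) := quot_mk (gact g (val a)).

Lemma quot_act_mk g x : quot_act g (quot_mk x) = quot_mk (gact g x).
Proof.
by apply/quot_mk_eq; rewrite -linearB; apply: sub_gact; apply: quot_mk_val.
Qed.

Definition quot_gmod : gmod k G.
Proof.
apply: (@Gmod k G quot_carrier quot_act).
- move=> g c a b; have [x ->] := quot_mk_surj a; have [y ->] := quot_mk_surj b.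
  by rewrite -quot_mk_linear !quot_act_mk linearP quot_mk_linear.
- by move=> a; have [x ->] := quot_mk_surj a; rewrite quot_act_mk gact1.
- by move=> g h a; have [x ->] := quot_mk_surj a; rewrite !quot_act_mk gactM.
Defined.

Definition quot_proj : ghom M quot_gmod.
Proof.
apply: (@Ghom _ _ M quot_gmod quot_mk) => [|g x]; first exact: quot_mk_linear.
by rewrite /= quot_act_mk.
Defined.

End QuotGmod.

Section ProdGmod.
Variables (k : fieldType) (G : groupType).

Definition zero_gmod : gmod k G.
Proof.
by apply: (@Gmod k G 'rV[k]_0 (fun _ x => x)).
Defined.

Variables M N : gmod k G.

Definition prod_gmod : gmod k G.
Proof.
apply: (@Gmod k G (M * N)%type (fun g x => (gact g x.1, gact g x.2))).
- by move=> g a x y; rewrite /= !linearP.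
- by case=> x y /=; rewrite !gact1.
- by move=> g h [x y]; rewrite /= !gactM.
Defined.

Definition prod_inl : ghom M prod_gmod.
Proof.
apply: (@Ghom _ _ M prod_gmod (fun x => (x, 0))) => [a x y|g x] /=.
  by congr pair; rewrite /= ?scaler0 ?addr0.
by rewrite linear0.
Defined.

Definition prod_inr : ghom N prod_gmod.
Proof.
apply: (@Ghom _ _ N prod_gmod (fun x => (0, x))) => [a x y|g x] /=.
  by congr pair; rewrite /= ?scaler0 ?addr0.
by rewrite linear0.
Defined.

Definition prod_fst : ghom prod_gmod M.
Proof. by apply: (@Ghom _ _ prod_gmod M fst). Defined.

Definition prod_snd : ghom prod_gmod N.
Proof. by apply: (@Ghom _ _ prod_gmod N snd). Defined.

End ProdGmod.

Section KernelImage.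
Variables (k : fieldType) (G : groupType) (M N : gmod k G) (f : ghom M N).

Definition ghom_ker : submodule M.
Proof.
apply: (@Submodule _ _ M (fun x => f x = 0)) => [|g x e].
  by exact: (subspace_preim (ghom_linear f) (@subspace_zero _ _)).
by rewrite ghom_equiv e linear0.
Defined.

Definition ghom_im : submodule N.
Proof.
apply: (@Submodule _ _ N (fun y => exists x, f x = y)) => [|g _ [x <-]].
  split=> [|a _ _ [x <-] [y <-]]; first by exists 0; rewrite linear0.
  by exists (a *: x + y); rewrite linearP.
by exists (gact g x); rewrite ghom_equiv.
Defined.

End KernelImage.

(** * Kernels, cokernels and products of objects *)

Section FreeFamilyImages.
Variables (F : closedFieldType) (k : fieldType) (M N : gmod k (SL2 F)).
Variable f : ghom M N.
Implicit Types (s : seq M) (r : seq N).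

Lemma ghom_eigenvector v : is_eigenvector v -> is_eigenvector (f v).
Proof.
move=> /eigenvectorP[lam wv]; apply/eigenvectorP; exists lam => t.
by rewrite -ghom_equiv wv linearZ.
Qed.

Lemma ghom_inj_eigenvector v : injective f -> is_eigenvector (f v) -> is_eigenvector v.
Proof.
move=> fi /eigenvectorP[lam wv]; apply/eigenvectorP; exists lam => t.
by apply: fi; rewrite ghom_equiv wv linearZ.
Qed.

Lemma ghom_up_fixed v : up_fixed v -> up_fixed (f v).
Proof. by move=> fv x; rewrite -ghom_equiv fv. Qed.

Lemma ghom_span s r v : (forall w, w \in s -> span r (f w)) -> span s v -> span r (f v).
Proof.
by move=> fs; apply: lspan_image => //; [exact: ghom_linear | exact: lspan_subspace].
Qed.

Lemma ghom_supported s r P m : (forall w, w \in s -> span r (f w)) ->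
  supported s P m -> supported r P (f m).
Proof.
move=> fs; apply: lspan_image; first exact: ghom_linear.
  exact: supported_subspace.
move=> _ [x Px [v Vv ->]]; rewrite ghom_equiv.
by apply: supported_gen => //; apply: ghom_span Vv.
Qed.

Lemma lspan_lift (A : M -> Prop) (B : N -> Prop) n :
    (forall y, B y -> exists2 x, A x & f x = y) ->
  lspan B n -> exists2 m, lspan A m & f m = n.
Proof.
move=> BA; elim=> {n} [|a y n /BA[x Ax <-] _ [m Am <-]].
  by exists 0; [apply: lspan0 | rewrite linear0].
by exists (a *: x + m); [apply: lspanZD | rewrite linearP].
Qed.

Lemma span_lift s v : span (map f s) v -> exists2 w, span s w & f w = v.
Proof. by apply: lspan_lift => _ /mapP[w ws ->]; exists w. Qed.

Lemma supported_lift s P n : supported (map f s) P n -> exists2 m, supported s P m & f m = n.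
Proof.
apply: lspan_lift => _ [x Px [v /span_lift[w Vw <-] ->]].
by exists (gact (up x) w); [exists x => //; exists w | rewrite ghom_equiv].
Qed.

End FreeFamilyImages.

Section FreeFamilyObjects.
Variables (F : closedFieldType) (p : nat) (k : fieldType).
Hypothesis pcF : p \in [pchar F].
Hypothesis alg : forall x : F, exists2 m, (0 < m)%N & x ^+ (p ^ m) = x.
Hypothesis char0 : [pchar k] =i pred0.

Lemma free_family_zero : free_family ([::] : seq (zero_gmod k (SL2 F))).
Proof.
split=> // m.
have -> : m = 0 by apply: thinmx0.
exact: lspan0.
Qed.

Lemma free_family_prod (M N : gmod k (SL2 F)) (s : seq M) (r : seq N) :
  free_family s -> free_family r ->
  free_family (map (prod_inl M N) s ++ map (prod_inr M N) r).
Proof.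
move=> gs gr; set b := _ ++ _.
have inl_b v : v \in s -> span b (prod_inl M N v).
  by move=> vs; apply: lspan_incl; rewrite mem_cat map_f.
have inr_b v : v \in r -> span b (prod_inr M N v).
  by move=> vs; apply: lspan_incl; rewrite mem_cat map_f ?orbT.
have fst_b v : v \in b -> span s (prod_fst M N v).
  rewrite mem_cat => /orP[] /mapP[w wr ->] /=; last exact: lspan0.
  exact: lspan_incl.
have snd_b v : v \in b -> span r (prod_snd M N v).
  rewrite mem_cat => /orP[] /mapP[w wr ->] /=; first exact: lspan0.
  exact: lspan_incl.
split.
- move=> v; rewrite mem_cat => /orP[] /mapP[w ws ->]; apply: ghom_eigenvector.
    exact: (family_eigen gs).
  exact: (family_eigen gr).
- move=> m.
  have -> : m = prod_inl M N (prod_fst M N m) + prod_inr M N (prod_snd M N m).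
    by case: m => x y; congr pair; rewrite /= ?addr0 ?add0r.
  apply: (subspaceD (supported_subspace _ _)).
    exact: ghom_supported inl_b (family_gen gs _).
  exact: ghom_supported inr_b (family_gen gr _).
move=> v Vv Ov x.
have f1 := family_free gs (ghom_span fst_b Vv) (ghom_supported fst_b Ov).
have f2 := family_free gr (ghom_span snd_b Vv) (ghom_supported snd_b Ov).
by case: v f1 f2 {Vv Ov} => v w f1 f2; congr pair; [apply: f1 | apply: f2].
Qed.

Variables (M N : gmod k (SL2 F)) (f : ghom M N) (s : seq M) (r : seq N).
Hypotheses (gs : free_family s) (gr : free_family r).

Lemma ghom_span_free_family v : span s v -> span r (f v).
Proof.
apply: ghom_span => w ws; apply: (eigenvector_span gr).
exact: ghom_eigenvector (family_eigen gs ws).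
Qed.

(** If a combination v of eigenvectors of N agrees modulo the image of f with a vector
    supported away from 0, say v - n = f m, then replacing v by v - f w, with w the
    component of m at 0, makes it supported away from 0, hence U-fixed. *)
Lemma free_family_coker : free_family (map (quot_proj (ghom_im f)) r).
Proof.
set pi := quot_proj _.
have pi_r v : v \in r -> span (map pi r) (pi v) by move=> vr; apply/lspan_incl/map_f.
split.
- by move=> _ /mapP[v vr ->]; apply: ghom_eigenvector; apply: (family_eigen gr).
- move=> a; have [x ->] := quot_mk_surj a.
  exact: (@ghom_supported _ _ _ _ pi) pi_r (family_gen gr x).
move=> _ /span_lift[v Vv <-] /supported_lift[n On env].
have [m em] : exists m, f m = v - n by apply/(quot_mk_eq (ghom_im f)).
have [w Vw Ow] := span_mod_open_cell gs m.
have -> : pi v = pi (v - f w).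
  by apply/(quot_mk_eq (ghom_im f)); rewrite opprB addrC subrK; exists w.
apply: ghom_up_fixed; apply: (family_free gr).
  by apply: subspaceB => //; [apply: lspan_subspace | apply: ghom_span_free_family].
have -> : v - f w = n + f (m - w) by rewrite linearB /= em addrA [n + _]addrC subrK.
apply: (subspaceD (supported_subspace _ _)) => //.
apply: ghom_supported Ow => x xs; apply: ghom_span_free_family; exact: lspan_incl.
Qed.

(** On the U-fixed vector f v, the element [lo 1 = up 1 * weyl * up 1] acts as
    [up 1 * weyl]. *)
Lemma ker_omega v : span s v -> up_fixed (f v) -> f (v + omega v) = 0.
Proof.
move=> Vv fv; rewrite /omega !(linearD, linearN) /= !ghom_equiv lo1 !gactM fv.
by rewrite subrr sub0r addrN.
Qed.

Lemma free_family_ker : exists t : seq (sub_gmod (ghom_ker f)), free_family t.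
Proof.
set K := sub_gmod _; pose i : ghom K M := sub_incl (ghom_ker f).
have ii : injective i by apply: val_inj.
have fi (x : K) : f (i x) = 0 by apply/asboolP/(valP x).
have lift x : f x = 0 -> exists y : K, i y = x.
  move=> fx; have xI : x \in in_sub (ghom_ker f) by apply/asboolP.
  by exists (exist _ x xI).
have [||//|t' [t'E _ Et']] := @indep_extend _ _
    (fun v => is_eigenvector v /\ f v = 0) s [::].
- by move=> v [/(eigenvector_span gs)].
- by [].
rewrite /= in Et'.
have [t et] : exists t : seq K, map i t = t'.
  elim: t' t'E {Et'} => [|x t' IH] t'E; first by exists [::].
  have [y ey] := lift x (t'E x (mem_head _ _)).2.
  have [z zt'|t <-] := IH; first by apply: t'E; rewrite inE zt' orbT.
  by exists (y :: t); rewrite map_cons ey.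
have span_ker v : span s v -> f v = 0 -> span t' v.
  move=> Vv fv; apply: (lspan_min (lspan_subspace _) Et').
  apply: (weight_components (L := fun v => f v = 0)) => //.
  - exact: (sub_subspace (ghom_ker f)).
  - by move=> a m; apply: (sub_gact (s := ghom_ker f)).
  exact: (span_eigen (family_eigen gs)).
have i_s v : v \in t -> span s (i v).
  move=> vt; apply: (eigenvector_span gs).
  by have /t'E[] : i v \in t' by rewrite -et map_f.
exists t; split.
- move=> v vt; apply: (ghom_inj_eigenvector ii).
  by have /t'E[] : i v \in t' by rewrite -et map_f.
- move=> m; have [S [phi [uS _ Vphi em]]] := supported_normal (family_gen gs (i m)).
  have fix_phi x : x \in S -> up_fixed (f (phi x)).
    apply: (family_coeff0 gr uS (phi := fun x => f (phi x))).
      by move=> y; apply: ghom_span_free_family.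
    rewrite -[RHS](fi m) em linear_sum; apply: eq_bigr => y _.
    by rewrite /= ghom_equiv.
  pose kap x := phi x + omega (phi x).
  have om x := omega_up_fixed pcF alg char0 gs (Vphi x).
  have em' : i m = \sum_(x <- S) gact (up x) (kap x) - \sum_(x <- S) omega (phi x).
    rewrite em -sumrB; apply: eq_bigr => x _.
    by rewrite linearD /= (om x).2 addrK.
  have fk x : x \in S -> f (kap x) = 0 by move=> xS; apply: ker_omega (fix_phi x xS).
  have f_sum : f (\sum_(x <- S) omega (phi x)) = 0.
    have := fi m; rewrite em' linearB linear_sum /= big_seq big1 => [|x xS].
      by rewrite sub0r => /eqP; rewrite oppr_eq0 => /eqP.
    by rewrite ghom_equiv fk // linear0.
  have : supported t' (fun=> True) (i m).
    rewrite em'; apply: (subspaceB (supported_subspace _ _)).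
      apply: (subspace_sum (supported_subspace _ _)) => x xS.
      apply: supported_gen => //; apply: span_ker; last exact: fk.
      by apply: (subspaceD (lspan_subspace _)) => //; case: (om x).
    apply: supported_span => //; apply: span_ker => //.
    by apply: (subspace_sum (lspan_subspace _)) => x _; case: (om x).
  by rewrite -et => /supported_lift[m' sm' /ii <-].
move=> v Vv Ov x; apply: ii; rewrite ghom_equiv.
exact: (family_free gs (ghom_span i_s Vv) (ghom_supported i_s Ov)).
Qed.

End FreeFamilyObjects.

(** * The abelian category *)

Section Factor.
Variables (k : fieldType) (G : groupType) (M N Z : gmod k G).

Lemma ghom_factor_inj (i : ghom M N) (h : ghom Z N) : injective i ->
  (forall z, exists x, i x = h z) -> exists! u : ghom Z M, ghom_comp i u = h.
Proof.
move=> ii /choice[u hu].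
have lu : linear u by move=> a x y; apply: ii; rewrite hu !linearP /= !hu.
have eu g x : u (gact g x) = gact g (u x) by apply: ii; rewrite hu !ghom_equiv hu.
exists (Ghom lu eu); split; first by apply: ghom_ext => z; apply: hu.
by move=> u' eu'; apply: ghom_ext => z /=; apply: ii; rewrite hu -eu'.
Qed.

Lemma ghom_factor_surj (q : ghom M N) (h : ghom M Z) : (forall y, exists x, q x = y) ->
  (forall x, q x = 0 -> h x = 0) -> exists! u : ghom N Z, ghom_comp u q = h.
Proof.
move=> sq ker_q; have [r qr] := choice sq.
have hE x y : q x = q y -> h x = h y.
  move=> e; apply/eqP; rewrite -subr_eq0 -linearB /= ker_q //.
  by rewrite linearB /= e subrr.
have lu : linear (fun y => h (r y)).
  by move=> a x y; rewrite -linearP; apply: hE; rewrite linearP /= !qr.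
have eu g y : h (r (gact g y)) = gact g (h (r y)).
  by rewrite -ghom_equiv; apply: hE; rewrite ghom_equiv !qr.
exists (Ghom lu eu); split; first by apply: ghom_ext => x /=; apply: hE; rewrite qr.
by move=> u' eu'; apply: ghom_ext => y /=; rewrite -eu' /= qr.
Qed.

End Factor.

Section Abelian.
Variables (F : closedFieldType) (p : nat) (k : fieldType).
Hypothesis pcF : p \in [pchar F].
Hypothesis alg : forall x : F, exists2 m, (0 < m)%N & x ^+ (p ^ m) = x.
Hypothesis char0 : [pchar k] =i pred0.
Local Notation C := (catC F k).

Let family_of (X : C) : exists s : seq (sval X), free_family s.
Proof. exact: (in_catC_free_family pcF alg char0 (svalP X)). Qed.

Let obj (M : gmod k (SL2 F)) (H : exists s : seq M, free_family s) : C :=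
  exist _ M (let: ex_intro s gs := H in free_family_in_catC gs).

Let ker_obj (X Y : C) (f : chom X Y) : exists s : seq (sub_gmod (ghom_ker f)), free_family s.
Proof.
have [s gs] := family_of X; have [r gr] := family_of Y.
exact: (free_family_ker pcF alg char0 f gs gr).
Qed.

Let coker_obj (X Y : C) (f : chom X Y) : exists s : seq (quot_gmod (ghom_im f)), free_family s.
Proof.
have [s gs] := family_of X; have [r gr] := family_of Y.
by exists (map (quot_proj (ghom_im f)) r); apply: (free_family_coker f gs gr).
Qed.

Let ker_incl (X Y : C) (f : chom X Y) : chom (obj (ker_obj f)) X := sub_incl (ghom_ker f).
Let coker_proj (X Y : C) (f : chom X Y) : chom Y (obj (coker_obj f)) := quot_proj (ghom_im f).

Let ker_inclE (X Y : C) (f : chom X Y) x : f x = 0 <-> exists y, ker_incl f y = x.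
Proof.
split=> [fx|[y <-]]; last by apply/asboolP/(valP y).
have xI : x \in in_sub (ghom_ker f) by apply/asboolP.
by exists (exist _ x xI).
Qed.

Let coker_projE (X Y : C) (f : chom X Y) y : coker_proj f y = 0 <-> exists x, f x = y.
Proof.
rewrite -[0]/(quot_mk (ghom_im f) 0); split=> [/(quot_mk_eq (ghom_im f))|H].
  by rewrite subr0.
by apply/(quot_mk_eq (ghom_im f)); rewrite subr0.
Qed.

Let coker_proj_surj (X Y : C) (f : chom X Y) a : exists y, coker_proj f y = a.
Proof. by have [y ->] := quot_mk_surj a; exists y. Qed.

Lemma catC_abelian : is_abelian C.
Proof.
have ext0 (X Y : C) (h : chom X Y) : (forall x, h x = 0) -> h = 0.
  by move=> H; apply: ghom_ext => x; rewrite H.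
have comp0 (X Y Z : C) (g : chom Y Z) (h : chom X Y) : ccomp g h = 0 -> forall x, g (h x) = 0.
  by move=> e x; have := congr1 (fun h : ghom _ _ => h x) e.
split.
- exists (obj (ex_intro _ _ (free_family_zero F k))) => X; split=> f; apply: ext0 => x.
    have -> : x = 0 by apply: thinmx0.
    exact: linear0.
  by apply: thinmx0.
- move=> X Y; have [s gs] := family_of X; have [r gr] := family_of Y.
  exists (obj (ex_intro _ _ (free_family_prod gs gr))), (prod_inl _ _), (prod_inr _ _),
    (prod_fst _ _), (prod_snd _ _).
  split; apply: ghom_ext => //.
  by case=> x y; congr pair; rewrite /= ?addr0 ?add0r.
- move=> X Y f; exists (obj (ker_obj f)), (ker_incl f); split.
    by apply: ext0 => x; apply/(ker_inclE f); exists x.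
  move=> Z h /comp0 fh; apply: ghom_factor_inj; first exact: val_inj.
  by move=> z; apply/(ker_inclE f).
- move=> X Y f; exists (obj (coker_obj f)), (coker_proj f); split.
    by apply: ext0 => x; apply/(coker_projE f); exists x.
  move=> Z h /comp0 hf; apply: ghom_factor_surj; first exact: coker_proj_surj.
  by move=> y /(coker_projE f)[x <-].
- move=> X Y f mono_f; exists (obj (coker_obj f)), (coker_proj f); split.
    by apply: ext0 => x; apply/(coker_projE f); exists x.
  move=> Z h /comp0 ph; apply: ghom_factor_inj; last by move=> z; apply/(coker_projE f).
  have i0 : ker_incl f = 0.
    apply: mono_f; apply: ghom_ext => x /=.
    by rewrite linear0; apply/(ker_inclE f); exists x.
  move=> x y e; have /(ker_inclE f)[z] : f (x - y) = 0 by rewrite linearB /= e subrr.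
  by rewrite i0 => /esym /subr0_eq.
move=> X Y f epi_f; exists (obj (ker_obj f)), (ker_incl f); split.
  by apply: ext0 => x; apply/(ker_inclE f); exists x.
move=> Z h /comp0 hi; apply: ghom_factor_surj; last by move=> x /(ker_inclE f)[y <-].
move=> y; apply/(coker_projE f).
suff -> : coker_proj f = 0 by [].
apply: epi_f; apply: ghom_ext => x /=.
by apply/(coker_projE f); exists x.
Qed.

End Abelian.

Theorem theorem4p3 (q : nat) (Fq : finFieldType) (hq : #|Fq| = q)
  (Fbar : closedFieldType) (iota : {rmorphism Fq -> Fbar})
  (halg : forall x : Fbar, algebraicOver iota x)
  (k : closedFieldType) (hk : [pchar k]%R =i pred0) :
  is_abelian (catC Fbar k).
Proof.
have [p p_pr pcFq] := finPcharP Fq.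
have pcF : p \in [pchar Fbar] := rmorph_pchar iota pcFq.
apply: (catC_abelian pcF) hk => x.
exact: (algebraic_frobenius_fixed pcF (halg x)).
Qed.
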